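(* Let $(X,\mathrm{d}\mu)$ be a $\sigma$-finite measure space and let $Y_1,\dots,Y_d$ be measure spaces. Let $1\le r_j<\infty$ and $\gamma_j>0$ for $1\le j\le d$. Let $T_j:\mathcal{S}(Y_j)\to\mathcal{M}(X)$ be linear (not necessarily positive) operators, each of which saturates $X$. Suppose that $$\int_X\prod_{j=1}^d|T_jf_j(x)|^{\gamma_j}\,\mathrm{d}\mu(x)\le A^{\sum_{j=1}^d\gamma_j}\prod_{j=1}^d\|f_j\|_{L^{r_j}(Y_j)}^{\gamma_j}$$ for all simple functions $f_j\in\mathcal{S}(Y_j)$, $1\le j\le d$. Then for every $(p_j)_{j=1}^d$ such that $\sum_{j=1}^d\gamma_j/p_j=1$ and $$\begin{cases}0<p_j<r_j&\text{for those } j \text{ for which } 1\le r_j<2,\\ 0<p_j\le 2&\text{for those } j\text{ for which } 2\le r_j<\infty,\end{cases}$$ there exist nonnegative measurable functions $\phi_1,\dots,\phi_d$ on $X$ such that $$\prod_{j=1}^d\phi_j(x)^{\gamma_j/p_j}\ge 1\quad\text{for a.e. }x\in X,$$ and such that for each $j$, $$\left(\int_X|T_jf_j(x)|^{p_j}\phi_j(x)\,\mathrm{d}\mu(x)\right)^{1/p_j}\le C A\|f_j\|_{L^{r_j}(Y_j)}\quad\text{for all } f_j\in\mathcal{S}(Y_j),$$ where $C$ is a finite constant depending only on the exponents $\{\gamma_j,r_j,p_j\}_{j=1}^d$.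
   Context: $\mathcal{M}(X)$ is the class of measurable functions on $X$. $\mathcal{S}(Y_j)$ is the space of simple functions on $Y_j$ (with finite norm), equipped with the $L^{r_j}(Y_j)$-norm. A linear map $T:\mathcal{Y}\to\mathcal{M}(X)$ saturates $X$ if for each measurable $E\subseteq X$ of positive measure there exist a measurable $E'\subseteq E$ with $\mu(E')>0$ and an $h\in\mathcal{Y}$ such that $|Th|>0$ a.e. on $E'$. *)

(* Defs.v *)
From HB Require Import structures.
From mathcomp Require Import all_boot all_order all_algebra.
From mathcomp Require Import all_classical all_reals all_analysis.
From mathcomp Require Import complex.

Set Implicit Arguments.
Unset Strict Implicit.
Unset Printing Implicit Defensive.

Import Order.TTheory GRing.Theory Num.Theory.
Import numFieldNormedType.Exports.

Local Open Scope classical_set_scope.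
Local Open Scope ring_scope.

(* The functions and operators are over a scalar field that is either R or
   R[i]; every notion below is uniform in that choice. *)
Inductive scalar_kind := RealScalars | ComplexScalars.

Definition scalar_field (R : realType) (k : scalar_kind) : numFieldType :=
  match k with
  | RealScalars => R
  | ComplexScalars => R[i]
  end.

(* The norm of R[i] as a numFieldType takes its values in R[i] itself, hence
   this R-valued absolute value. *)
Definition modulus (R : realType) (k : scalar_kind) : scalar_field R k -> R :=
  match k return scalar_field R k -> R with
  | RealScalars => fun x : R => `|x|
  | ComplexScalars => fun z : R[i] => ComplexField.Normc.normc z
  end.

Definition scalar_measurable (R : realType) (k : scalar_kind)
    (dX : measure_display) (X : measurableType dX) :
    (X -> scalar_field R k) -> Prop :=
  match k return (X -> scalar_field R k) -> Prop with
  | RealScalars => fun f : X -> R => measurable_fun [set: X] f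
  | ComplexScalars => fun f : X -> R[i] =>
      measurable_fun [set: X] (@complex.Re R \o f) /\
      measurable_fun [set: X] (@complex.Im R \o f)
  end.

Section OneMeasureSpace.
Context (R : realType) (k : scalar_kind).
Context (dY : measure_display) (Y : measurableType dY).
Context (nu : {measure set Y -> \bar R}).

Definition Lr_norm (r : R) (f : Y -> scalar_field R k) : \bar R :=
  Lnorm nu r%:E (fun y => (modulus (f y))%:E).

(* The space S(Y): simple functions with finite L^r norm. *)
Definition simple_Lr (r : R) : set (Y -> scalar_field R k) :=
  [set f | [/\ scalar_measurable f, finite_set (range f)
             & (Lr_norm r f < +oo)%E]].

End OneMeasureSpace.

Section Operators.
Context (R : realType) (k : scalar_kind).
Context (dX : measure_display) (X : measurableType dX).
Context (mu : {measure set X -> \bar R}).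
Context (Y : Type).

(* T is a linear map from D to the measurable functions on X, the latter being
   taken up to a.e. equality; the values of T outside D are irrelevant. *)
Definition linear_operator (D : set (Y -> scalar_field R k))
    (T : (Y -> scalar_field R k) -> (X -> scalar_field R k)) : Prop :=
  (forall f, D f -> scalar_measurable (T f)) /\
  (forall (a : scalar_field R k) f g, D f -> D g ->
     {ae mu, forall x, T (fun y => a * f y + g y) x = a * T f x + T g x}).

Definition saturates (D : set (Y -> scalar_field R k))
    (T : (Y -> scalar_field R k) -> (X -> scalar_field R k)) : Prop :=
  forall E : set X, measurable E -> (0 < mu E)%E ->
    exists E' : set X, [/\ measurable E', E' `<=` E, (0 < mu E')%E
      & exists2 h, D h & {ae mu, forall x, E' x -> 0 < modulus (T h x)}].

End Operators.

(* Main.v *)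
Require Import Defs.
From HB Require Import structures.
From mathcomp Require Import all_boot all_order all_algebra.
From mathcomp Require Import all_classical all_reals all_analysis.
From mathcomp Require Import measurable_realfun complex ring lra.

Set Implicit Arguments.
Unset Strict Implicit.
Unset Printing Implicit Defensive.

Import Order.TTheory GRing.Theory Num.Theory.
Import numFieldNormedType.Exports.

Local Open Scope classical_set_scope.
Local Open Scope ring_scope.

(** Write [th j = gamma j / p j]; these numbers are positive with sum one, and in
particular [gamma j <= p j]. The theorem has two independent halves.

The first half is a vector-valued extension. Fix one operator [T] and absorb
all other factors of the product into a weight [omega]. An inequality
[\int |T f|^g omega <= B ||f||_r^g] for single simple functions improves itself
to [\int (sum_i w_i |T f_i|^p)^(g/p) omega <= C B] for all probability weights
[w] and all [f_i] in the unit ball, with [C] depending on [g], [r], [p] only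
([vector_valued_bound]). One inserts random signed sums of the [f_i]: on the
side of [T] they dominate each single [|T f_i|^g], and even the square function
by Khintchine ([khintchine_lower]), while in [L^r] they are controlled because
[L^r] has type [t = min r 2] ([signavg_type]). If [p = t = 2] this is the claim.
If [p < t], one applies it to [2^l] independent samples of the [f_i] drawn with
law [w]: the largest sampled value controls the quantile of order [2^-l] of
[|T f_i|], and the weighted [p]-sum is recovered by summing over dyadic
quantiles, a geometric series with ratio [2 ^ (g/t - g/p) < 1]
([weighted_sum_le_dyadic]). Doing this for one factor after the other
([replace_factors]) bounds [\int prod_j u_j^(th j)] uniformly over the convex
sets [K_j] of functions [u_j = sum_i w_i |T_j f_i|^(p j)].

The second half is a convex optimization ([convex_factorization]). If the
[u_j] in [K_j] maximized [\int prod_j u_j^(th j)] and were positive, then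
[phi_j = prod_i u_i^(th i) / u_j] would do: its geometric mean is one, and the
first-order condition for the concave functional says that
[\int v phi_j <= \int prod_i u_i^(th i)] for every [v] in [K_j]. Maximizers need
not exist, so the argument is run with near-maximizers over the slightly
smaller sets [dl h + (1 - dl) K_j], where [h] is a function that saturation
makes positive almost everywhere in the limit ([power_sums_exhaustion]). The
price is a truncation in the test integrals, which disappears as [dl] tends to
zero. The weights passing the truncated tests form a decreasing sequence of
nonempty convex sets; minimizing the strictly convex functional
[\int rho sum_j exp (- phi_j)] over them yields a sequence that converges almost
everywhere ([decreasing_convex_cvg]), and Fatou's lemma passes all conditions
to the limit. Finally the powers of [A] are distributed among the [phi_j] by
rescaling with factors whose weighted geometric mean is one. *)

(** * The modulus on the scalar field *)

Section Modulus.
Context (R : realType) (k : scalar_kind).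
Implicit Types (x y z : scalar_field R k).

Definition ofR : R -> scalar_field R k :=
  match k return R -> scalar_field R k with
  | RealScalars => fun a => a
  | ComplexScalars => fun a => a%:C%C
  end.

Lemma modulus_ge0 x : 0 <= modulus x.
Proof. by case: k x => [x|[a b]] /=; [exact: normr_ge0|exact: sqrtr_ge0]. Qed.

Lemma modulus0 : modulus (0 : scalar_field R k) = 0.
Proof. by case: k => /=; [exact: normr0|exact: ComplexField.Normc.normc0]. Qed.

Lemma modulusM x y : modulus (x * y) = modulus x * modulus y.
Proof.
by case: k x y => x y /=; [exact: normrM|exact: ComplexField.Normc.normcM].
Qed.

Lemma modulusN x : modulus (- x) = modulus x.
Proof. by case: k x => x /=; [exact: normrN|exact: normcN]. Qed.

Lemma modulusD x y : modulus (x + y) <= modulus x + modulus y.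
Proof. by case: k x y => x y /=; [exact: ler_normD|exact: le_normcD]. Qed.

Lemma modulus_ofR (a : R) : modulus (ofR a) = `|a|.
Proof.
rewrite /ofR; case: k => //=; first by rewrite expr0n/= addr0 sqrtr_sqr.
Qed.

Lemma modulus_cross x y : exists q : R,
  [/\ modulus (x + y) ^+ 2 = modulus x ^+ 2 + modulus y ^+ 2 + q,
      modulus (x - y) ^+ 2 = modulus x ^+ 2 + modulus y ^+ 2 - q &
      `|q| <= 2 * modulus x * modulus y].
Proof.
case: k x y => [x y|[a b] [c e]] /=.
  exists (2 * x * y); rewrite !real_normK ?num_real//.
  by split; [ring|ring|rewrite !normrM normr_nat].
exists (2 * (a * c + b * e)); rewrite !sqr_sqrtr ?addr_ge0 ?sqr_ge0//.
split; [ring|ring|].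
rewrite normrM normr_nat -mulrA ler_pM2l// -sqrtrM ?addr_ge0 ?sqr_ge0//.
rewrite -sqrtr_sqr ler_wsqrtr//.
rewrite -subr_ge0 (_ : _ - _ = (a * e - b * c) ^+ 2) ?sqr_ge0//; ring.
Qed.

End Modulus.

(** * Elementary inequalities for real powers *)

Section Powers.
Context {R : realType}.
Implicit Types (x y a m : R).

(** The tangent line of the concave function [x `^ a] at [1]; all power
    inequalities below come from it. *)
Lemma powR_le_tangent x a : 0 <= x -> 0 < a <= 1 -> x `^ a <= 1 + a * (x - 1).
Proof.
move=> x0 /andP[a0 a1]; have [->|xn0] := eqVneq x 0.
  by rewrite powR0 ?gt_eqF//; lra.
have {xn0 x0} x0 : 0 < x by rewrite lt_neqAle eq_sym xn0.
rewrite /powR gt_eqF//; set l := ln x.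
have -> : x = expR l by rewrite lnK.
have h1 : expR (a * l) * (1 + (l - a * l)) <= expR l.
  rewrite -[leRHS](_ : expR (a * l) * expR (l - a * l) = _).
    by rewrite ler_pM2l ?expR_gt0// expR_ge1Dx.
  by rewrite -expRD; congr expR; ring.
have h2 : expR (a * l) * (1 - a * l) <= 1.
  rewrite -[leRHS](_ : expR (a * l) * expR (- (a * l)) = _).
    by rewrite ler_pM2l ?expR_gt0// expR_ge1Dx.
  by rewrite -expRD subrr expR0.
have := lerD (ler_wpM2l (ltW a0) h1) (ler_wpM2l (_ : 0 <= 1 - a) h2).
rewrite subr_ge0 => /(_ a1) h.
rewrite (_ : 1 + a * _ = a * expR l + (1 - a) * 1); last by ring.
by apply: le_trans h; rewrite le_eqVlt; apply/orP; left; apply/eqP; ring.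
Qed.

Lemma powR_ge_tangent x m : 0 <= x -> 1 <= m -> 1 + m * (x - 1) <= x `^ m.
Proof.
move=> x0 m1; have m0 : 0 < m by lra.
have := @powR_le_tangent (x `^ m) m^-1 (powR_ge0 _ _).
rewrite invr_gt0 m0 invf_le1// m1 => /(_ isT).
rewrite -powRrM mulfV ?gt_eqF// powRr1// => h.
have := ler_wpM2l (ltW m0) h.
rewrite mulrDr mulr1 mulrA mulfV ?gt_eqF// mul1r; lra.
Qed.

Lemma powRD_le x y a : 0 <= x -> 0 <= y -> 0 < a <= 1 ->
  (x + y) `^ a <= x `^ a + y `^ a.
Proof.
move=> x0 y0 /andP[a0 a1].
have [xy0|xyn0] := eqVneq (x + y) 0.
  by rewrite xy0 powR0 ?gt_eqF// addr_ge0// powR_ge0.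
have s0 : 0 < x + y by rewrite lt_neqAle eq_sym xyn0 addr_ge0.
have main z : 0 <= z <= x + y -> z / (x + y) * (x + y) `^ a <= z `^ a.
  move=> /andP[z0 zs]; have [->|zn0] := eqVneq z 0.
    by rewrite !mul0r powR_ge0.
  rewrite -[in leRHS](divfK xyn0 z) [in leRHS]powRM ?divr_ge0 ?(ltW s0)//.
  rewrite ler_wpM2r ?powR_ge0// ger1_powR// ler_pdivrMr// mul1r zs andbT.
  by rewrite divr_gt0// lt_neqAle eq_sym zn0.
have hx := main x; have hy := main y; have := lerD (hx _) (hy _).
rewrite x0 y0 lerDl y0 lerDr x0 => /(_ isT isT).
by rewrite -mulrDl -mulrDl mulfV// mul1r.
Qed.

Lemma powR_sum_le (I : Type) (s : seq I) (F : I -> R) a :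
  (forall i, 0 <= F i) -> 0 < a <= 1 ->
  (\sum_(i <- s) F i) `^ a <= \sum_(i <- s) F i `^ a.
Proof.
move=> F0 a01; elim: s => [|i s ih].
  by rewrite !big_nil powR0// gt_eqF//; case/andP: a01.
rewrite !big_cons (le_trans (powRD_le _ _ a01)) ?sumr_ge0// lerD2l//.
Qed.

Lemma powR_mid_concave x y a : 0 <= x -> 0 <= y -> 0 < a <= 1 ->
  x `^ a + y `^ a <= 2 * ((x + y) / 2) `^ a.
Proof.
move=> x0 y0 a01; have /andP[a0 a1] := a01.
have [m mE] : exists m, m = (x + y) / 2 by eexists.
rewrite -mE; have [m0|mn0] := eqVneq m 0.
  have [-> ->] : x = 0 /\ y = 0 by split; lra.
  by rewrite m0 powR0 ?gt_eqF//; lra.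
have m0 : 0 < m by rewrite lt_neqAle eq_sym mn0 mE divr_ge0 ?addr_ge0.
have main z : 0 <= z -> z `^ a <= m `^ a * (1 + a * (z / m - 1)).
  move=> z0; rewrite -[in leLHS](divfK mn0 z) powRM ?divr_ge0 ?(ltW m0)//.
  by rewrite mulrC ler_wpM2l ?powR_ge0// powR_le_tangent// divr_ge0 ?(ltW m0).
have hx := main x x0; have hy := main y y0.
apply: (le_trans (lerD hx hy)).
rewrite -mulrDr mulrC ler_wpM2r ?powR_ge0//.
rewrite (_ : _ + _ = 2 + a * ((x + y) / m - 2)); last by ring.
have -> : (x + y) / m = 2 by rewrite (_ : x + y = 2 * m) ?mE ?mulfK//; lra.
by rewrite subrr mulr0 addr0.
Qed.

(** Jensen's inequality for sub-probability weights. *)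
Lemma powR_jensen (I : Type) (s : seq I) (w F : I -> R) m :
  (forall i, 0 <= F i) -> (forall i, 0 <= w i) -> \sum_(i <- s) w i <= 1 ->
  1 <= m ->
  (\sum_(i <- s) w i * F i) `^ m <= \sum_(i <- s) w i * F i `^ m.
Proof.
move=> F0 w0 W1 m1; set c := \sum_(i <- s) w i * F i.
have rhs0 : 0 <= \sum_(i <- s) w i * F i `^ m.
  by apply: sumr_ge0 => i _; rewrite mulr_ge0// powR_ge0.
have [c0|cn0] := eqVneq c 0; first by rewrite c0 powR0 ?gt_eqF//; lra.
have c0 : 0 < c.
  by rewrite lt_neqAle eq_sym cn0; apply: sumr_ge0 => i _; rewrite mulr_ge0.
have main i : w i * (c `^ m * (1 + m * (F i / c - 1))) <= w i * F i `^ m.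
  rewrite ler_wpM2l// -[in leRHS](divfK cn0 (F i)).
  rewrite powRM ?divr_ge0 ?(ltW c0)// mulrC.
  by rewrite ler_wpM2r ?powR_ge0// powR_ge_tangent// divr_ge0 ?(ltW c0).
apply: le_trans (ler_sum _ (fun i _ => main i)).
have -> : \sum_(i <- s) w i * (c `^ m * (1 + m * (F i / c - 1)))
        = c `^ m * ((1 - m) * (\sum_(i <- s) w i) + m / c * c).
  rewrite {3}/c !mulr_sumr -big_split/= mulr_sumr.
  by apply: eq_bigr => i _; ring.
rewrite divfK// -[leLHS]mulr1 ler_wpM2l ?powR_ge0//.
have : 0 <= (m - 1) * (1 - \sum_(i <- s) w i) by rewrite mulr_ge0 ?subr_ge0.
by move=> h; rewrite -subr_ge0; apply: le_trans h _; rewrite le_eqVlt; apply/orP; left; apply/eqP; ring.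
Qed.

End Powers.
(** * Averages over random signs *)

Section SignAvg.
Context {R : realType} {V : zmodType}.
Implicit Types (G H : V -> R) (s : seq V) (u v z : V).

(** The expectation of [G] at [v] plus the sum of [s] with independent random
    signs; the recursion on [s] makes all moment bounds inductions. *)
Fixpoint signavg G s v : R :=
  if s is z :: s' then (signavg G s' (v + z) + signavg G s' (v - z)) / 2 else G v.

Lemma signavg_le G H s v : (forall u, G u <= H u) -> signavg G s v <= signavg H s v.
Proof.
move=> GH; elim: s v => [|z s ih] v //=.
by rewrite ler_pM2r ?invr_gt0// lerD.
Qed.

Lemma signavg_affine (a b : R) G s v :
  signavg (fun u => a * G u + b) s v = a * signavg G s v + b.
Proof. by elim: s v => [|z s ih] v //=; rewrite !ih; field. Qed.

Lemma signavgD G H s v : signavg (fun u => G u + H u) s v = signavg G s v + signavg H s v.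
Proof. by elim: s v => [|z s ih] v //=; rewrite !ih; field. Qed.

Lemma signavg_ge0 G s v : (forall u, 0 <= G u) -> 0 <= signavg G s v.
Proof.
move=> G0; elim: s v => [|z s ih] v //=.
by rewrite divr_ge0// addr_ge0.
Qed.

Lemma signavg_shift G s u v : signavg G s (v + u) = signavg (fun z => G (z + u)) s v.
Proof.
elim: s v => [|z s ih] v //=.
by rewrite -!ih (addrAC v u z) (addrAC v u (- z)).
Qed.

End SignAvg.

(** Used both for homogeneity and to move the signs across a linear map. *)
Lemma signavg_map (R : realType) (V V' : zmodType) (f : V -> V') (G : V' -> R)
    (H : V -> R) (c : R) s v :
  {morph f : x y / x + y} -> {morph f : x y / x - y} ->
  (forall u, G (f u) = c * H u) ->
  signavg G [seq f z | z <- s] (f v) = c * signavg H s v.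
Proof.
move=> fD fB GH; elim: s v => [|z s ih] v //=.
by rewrite -fD -fB !ih; field.
Qed.

Section SignAverages.
Context {R : realType} {k : scalar_kind}.
Local Notation F := (scalar_field R k).
Local Notation M := (@modulus R k).
Implicit Types (s : seq F) (v z : F).

Lemma modulus_parallelogram v z :
  (M (v + z) ^+ 2 + M (v - z) ^+ 2) / 2 = M v ^+ 2 + M z ^+ 2.
Proof. by have [q [-> -> _]] := modulus_cross v z; field. Qed.

Lemma signavg_sqr s v :
  signavg (fun z => M z ^+ 2) s v = M v ^+ 2 + \sum_(z <- s) M z ^+ 2.
Proof.
elim: s v => [|z s ih] v /=; first by rewrite big_nil addr0.
by rewrite !ih big_cons [RHS]addrA -modulus_parallelogram; field.
Qed.

(** Concavity of [x `^ (r / 2)] reduces this case of Clarkson's inequality to the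
    parallelogram law. *)
Lemma modulus_clarkson (r : R) v z : 1 <= r <= 2 ->
  (M (v + z) `^ r + M (v - z) `^ r) / 2 <= M v `^ r + M z `^ r.
Proof.
move=> /andP[r1 r2].
have pE x : 0 <= x -> x `^ r = (x ^+ 2) `^ (r / 2).
  by move=> x0; rewrite -powR_mulrn// -powRrM; congr (_ `^ _); field.
rewrite !pE ?modulus_ge0//.
have a01 : 0 < r / 2 <= 1 by apply/andP; split; lra.
rewrite ler_pdivrMr// [leRHS]mulrC.
apply: (le_trans (powR_mid_concave (sqr_ge0 _) (sqr_ge0 _) a01)).
rewrite ler_pM2l// modulus_parallelogram.
by rewrite powRD_le// sqr_ge0.
Qed.

Lemma signavg_clarkson (r : R) s v : 1 <= r <= 2 ->
  signavg (fun z => M z `^ r) s v <= M v `^ r + \sum_(z <- s) M z `^ r.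
Proof.
move=> r12; elim: s v => [|z s ih] v /=; first by rewrite big_nil addr0.
rewrite big_cons addrA.
have := modulus_clarkson v z r12; have := ih (v + z); have := ih (v - z); lra.
Qed.

(** The left side is an even polynomial in [x] with nonnegative coefficients, so
    it lies below its chord in [x ^+ 2]; the induction carries along the odd
    part. *)
Lemma even_binomial_le (x : R) m : `|x| <= 1 ->
  (1 + x) ^+ m + (1 - x) ^+ m <= 2 * (1 + 2 ^+ m * x ^+ 2).
Proof.
move=> x1; have /andP[xl xu] : -1 <= x <= 1 by rewrite -ler_norml.
suff: [/\ (1 + x) ^+ m + (1 - x) ^+ m <= 2 * (1 + 2 ^+ m * x ^+ 2),
  (1 + x) ^+ m + (1 - x) ^+ m <= 2 * 2 ^+ m &
  x * ((1 + x) ^+ m - (1 - x) ^+ m) <= 2 * 2 ^+ m * x ^+ 2] by case.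
have x20 : 0 <= x ^+ 2 by exact: sqr_ge0.
have x21 : x ^+ 2 <= 1 by rewrite -real_normK ?num_real// expr_le1.
elim: m => [|m [ih1 ih2 ih3]].
  rewrite !expr0; split; lra.
have p0 : 0 <= 2 ^+ m :> R by rewrite exprn_ge0.
have h : 2 ^+ m * x ^+ 2 <= 2 ^+ m by rewrite ler_piMr.
have a0 : 0 <= (1 + x) ^+ m + (1 - x) ^+ m.
  by rewrite addr_ge0// exprn_ge0; lra.
have h2 := ler_wpM2l x20 ih2.
rewrite !(exprS _ m) in ih1 ih2 ih3 h h2 *.
set P := (1 + x) ^+ m in ih1 ih2 ih3 a0 h2 *.
set Q := (1 - x) ^+ m in ih1 ih2 ih3 a0 h2 *.
set T := 2 ^+ m in p0 ih1 ih2 ih3 h h2 *.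
have -> : (1 + x) * P + (1 - x) * Q = (P + Q) + x * (P - Q) by ring.
have -> : x * ((1 + x) * P - (1 - x) * Q)
  = x * (P - Q) + x ^+ 2 * (P + Q) by ring.
split; lra.
Qed.

Definition mom (m : nat) : R := 4 * 2 ^+ m + 1.

Lemma mom_ge1 m : 1 <= mom m.
Proof. by rewrite /mom lerDr mulr_ge0// exprn_ge0. Qed.

(** Averaging over one sign: [P] collects all squares and [q] is the cross term,
    whose square is bounded by [P] times the new square [b]. *)
Lemma even_moment_step (P q b : R) m : (0 < m)%N -> 0 <= P -> 0 <= b ->
  `|q| <= P -> q ^+ 2 <= 4 * P * b ->
  ((P + q) ^+ m + (P - q) ^+ m) / 2 <= (P + 4 * 2 ^+ m * b) ^+ m.
Proof.
move=> m0 P0 b0 qP qb.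
have K0 : 0 <= 4 * 2 ^+ m * b :> R by rewrite !mulr_ge0// exprn_ge0.
have [PE|Pn0] := eqVneq P 0.
  move: qP; rewrite PE normr_le0 => /eqP ->.
  rewrite !add0r oppr0 expr0n gtn_eqF//= addr0 mul0r exprn_ge0//.
have {Pn0 P0} P0 : 0 < P by rewrite lt_neqAle eq_sym Pn0.
have [x qE] : exists x, q = P * x by exists (q / P); rewrite mulrCA mulfV ?mulr1 ?gt_eqF.
have x1 : `|x| <= 1.
  by move: qP; rewrite qE normrM (gtr0_norm P0) ger_pMr.
have T0 : 0 <= 2 ^+ m * x ^+ 2 by rewrite mulr_ge0 ?sqr_ge0 ?exprn_ge0.
have -> : P + q = P * (1 + x) by rewrite qE; ring.
have -> : P - q = P * (1 - x) by rewrite qE; ring.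
rewrite !exprMn -mulrDr ler_pdivrMr//.
apply: (@le_trans _ _ (P ^+ m * (2 * (1 + 2 ^+ m * x ^+ 2)))).
  by rewrite ler_pM2l ?exprn_gt0// even_binomial_le.
rewrite mulrCA mulrC ler_pM2r//.
apply: (@le_trans _ _ (P ^+ m * (1 + 2 ^+ m * x ^+ 2) ^+ m)).
  rewrite ler_pM2l ?exprn_gt0//; case: m m0 T0 {K0} => // n _ T0.
  rewrite [leRHS]exprS ler_peMr ?addr_ge0//.
  by rewrite exprn_ege1// lerDl.
rewrite -exprMn lerXn2r ?nnegrE//.
- by rewrite mulr_ge0 ?(ltW P0)// addr_ge0.
- by rewrite addr_ge0// ltW.
rewrite mulrDr mulr1 lerD2l mulrCA [leRHS](_ : _ = 2 ^+ m * (4 * b)); last by ring.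
rewrite ler_wpM2l ?exprn_ge0//.
have := qb; rewrite qE (_ : (P * x) ^+ 2 = P * (P * x ^+ 2)); last by ring.
by rewrite (_ : 4 * P * b = P * (4 * b)) ?ler_pM2l//; ring.
Qed.

(** The offset [c] is what makes the induction over the signs close: it carries
    the contribution of the signs already averaged. *)
Lemma signavg_even_moment s v (c : R) m : (0 < m)%N -> 0 <= c ->
  signavg (fun z => (M z ^+ 2 + c) ^+ m) s v
  <= (M v ^+ 2 + mom m * (\sum_(z <- s) M z ^+ 2) + c) ^+ m.
Proof.
move=> m0 c0; elim: s v => [|z s ih] v /=.
  by rewrite big_nil mulr0 addr0.
rewrite big_cons; set S := \sum_(z <- s) _ in ih *.
have S0 : 0 <= mom m * S.
  rewrite mulr_ge0// ?(le_trans _ (mom_ge1 m))// sumr_ge0// => i _.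
  exact: sqr_ge0.
have [q [q1 q2 q3]] := modulus_cross v z.
have := ih (v + z); have := ih (v - z); rewrite q1 q2 => h1 h2.
set a := M v in q1 q2 q3 h1 h2 *; set b := M z in q1 q2 q3 h1 h2 *.
have a0 : 0 <= a := modulus_ge0 v; have b0 : 0 <= b := modulus_ge0 z.
pose P := a ^+ 2 + b ^+ 2 + mom m * S + c.
have P1 : `|q| <= P.
  rewrite (le_trans q3)// /P; have := sqr_ge0 (a - b).
  by rewrite sqrrB; lra.
have P2 : q ^+ 2 <= 4 * P * b ^+ 2.
  rewrite -real_normK ?num_real//.
  have : `|q| ^+ 2 <= (2 * a * b) ^+ 2.
    by rewrite lerXn2r ?nnegrE// !mulr_ge0.
  move=> /le_trans; apply.
  rewrite (_ : (2 * a * b) ^+ 2 = 4 * a ^+ 2 * b ^+ 2); last by ring.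
  rewrite ler_wpM2r ?sqr_ge0// ler_pM2l// /P.
  by have := sqr_ge0 b; lra.
have P0 : 0 <= P by rewrite (le_trans _ P1).
have := even_moment_step m0 P0 (sqr_ge0 b) P1 P2.
rewrite [P + q](_ : _ = a ^+ 2 + b ^+ 2 + q + mom m * S + c); last by rewrite /P; ring.
rewrite [P - q](_ : _ = a ^+ 2 + b ^+ 2 - q + mom m * S + c); last by rewrite /P; ring.
rewrite [P + _](_ : _ = a ^+ 2 + mom m * (b ^+ 2 + S) + c); last by rewrite /P /mom; ring.
by apply: le_trans; rewrite ler_pM2r ?invr_gt0// lerD.
Qed.

(** The sign of [z] alone suffices: one of [u + z] and [u - z] has modulus at
    least that of [z]. *)
Lemma signavg_ge_coord (g : R) s v z : 0 < g -> z \in s ->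
  M z `^ g <= 2 * signavg (fun z => M z `^ g) s v.
Proof.
move=> g0; elim: s v => // y s ih v; rewrite inE => /orP[/eqP <-|zs] /=.
  rewrite mulrC divfK// signavg_shift.
  rewrite (_ : v - z = v + (- z))// (signavg_shift _ _ (- z)) -signavgD.
  rewrite -[leLHS](_ : signavg (fun=> 0 * (0 : R) + M z `^ g) s v = _); last first.
    by rewrite (signavg_affine 0 _ (fun=> 0)) mul0r add0r.
  apply: signavg_le => u; rewrite mul0r add0r.
  have : M z <= M (u + z) \/ M z <= M (u - z).
    have : M (z + z) <= M (u + z) + M (u - z).
      rewrite -(modulusN (u - z)) (_ : z + z = u + z + (- (u - z))) ?modulusD//.
      by ring.
    have -> : M (z + z) = 2 * M z.
      have [q [q1 q2 q3]] := modulus_cross z z.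
      move: q2; rewrite subrr modulus0 expr0n/= => q2.
      apply/eqP; rewrite -(@eqrXn2 _ 2) ?mulr_ge0 ?modulus_ge0// q1; apply/eqP.
      by nra.
    by have [|] := leP (M z) (M (u + z)); [left|right; lra].
  have p0 x : 0 <= x `^ g :> R by exact: powR_ge0.
  move=> [] h; [rewrite -[leLHS]addr0|rewrite -[leLHS]add0r]; apply: lerD => //;
  by rewrite ge0_ler_powR ?nnegrE ?modulus_ge0// ltW.
by have := ih (v + y) zs; have := ih (v - y) zs; lra.
Qed.

End SignAverages.
Section TypeAndCotype.
Context {R : realType}.

Definition type_exponent (r : R) : R := Num.min r 2.

Definition type_const (r : R) : R :=
  let m := (Num.truncn r).+1 in 1 + (mom m) ^+ m.

Lemma type_const_ge1 r : 1 <= type_const r.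
Proof. by rewrite /type_const lerDl exprn_ge0// (le_trans _ (mom_ge1 _)). Qed.

Context {k : scalar_kind}.
Local Notation F := (scalar_field R k).
Local Notation M := (@modulus R k).

Lemma modulus_eq0 (z : F) : M z = 0 -> z = 0.
Proof.
case: k z => z /=; first by move/normr0P/eqP.
exact: ComplexField.Normc.eq0_normc.
Qed.

Lemma signavg_zeros (G : F -> R) (s : seq F) v :
  (forall z, z \in s -> z = 0) -> signavg G s v = G v.
Proof.
elim: s v => [|z s ih] v //= h.
have -> : z = 0 by apply: h; rewrite mem_head.
rewrite subr0 addr0 ih; first by field.
by move=> y ys; apply: h; rewrite inE ys orbT.
Qed.

(** Khintchine's upper bound, deduced from an even moment of order [2 * m >= r]:
    with [u = |z|^2 / S], [u^(r/2) <= 1 + u^m]. *)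
Lemma signavg_ge2 (r : R) (s : seq F) : 2 <= r ->
  signavg (fun z => M z `^ r) s 0
  <= type_const r * (\sum_(z <- s) M z ^+ 2) `^ (r / 2).
Proof.
move=> r2; set S := \sum_(z <- s) _.
have S0 : 0 <= S by rewrite sumr_ge0// => i _; exact: sqr_ge0.
have [SE|Sn0] := eqVneq S 0.
  rewrite signavg_zeros => [|z zs].
    rewrite modulus0 powR0 ?gt_eqF ?mulr_ge0 ?powR_ge0//; last by lra.
    by rewrite (le_trans _ (type_const_ge1 r)).
  apply: modulus_eq0; apply/eqP; rewrite -sqrf_eq0.
  move/eqP: SE; rewrite psumr_eq0 => [/allP/(_ _ zs)//|y _].
  exact: sqr_ge0.
have {Sn0 S0} S0 : 0 < S by rewrite lt_neqAle eq_sym Sn0.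
rewrite /type_const; set m := (Num.truncn r).+1.
have rm : r <= m%:R by rewrite ltW// /m; have /andP[] := truncn_itv (le_trans (ler0n R 2) r2).
have H := @signavg_even_moment R k s 0 0 m isT (lexx _).
rewrite modulus0 expr0n/= add0r addr0 -/S exprMn in H.
set c := S `^ (r / 2).
have c0 : 0 < c by rewrite powR_gt0.
have pw z : M z `^ r <= (c / S ^+ m) * (M z ^+ 2 + 0) ^+ m + c.
  rewrite addr0; set u := M z ^+ 2 / S.
  have u0 : 0 <= u by rewrite divr_ge0 ?sqr_ge0// ltW.
  have -> : M z `^ r = c * u `^ (r / 2).
    rewrite -(powRM _ (ltW S0) u0) /u mulrCA mulfV ?gt_eqF// mulr1.
    rewrite -powR_mulrn ?modulus_ge0// -powRrM; by congr (_ `^ _); field.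
  have -> : c / S ^+ m * (M z ^+ 2) ^+ m = c * u ^+ m.
    by rewrite /u expr_div_n mulrAC mulrA.
  rewrite -[X in _ + X]mulr1 -mulrDr ler_pM2l//.
  have [u1|u1] := leP u 1.
    rewrite (le_trans (_ : _ <= 1)) ?lerDr ?exprn_ge0//.
    apply: (@le_trans _ _ (1 `^ (r / 2))); last by rewrite powR1.
    by rewrite ge0_ler_powR ?nnegrE//; lra.
  rewrite (le_trans (_ : _ <= u ^+ m)) ?lerDl// -powR_mulrn//.
  by rewrite ler_powR ?(ltW u1)//; lra.
apply: (le_trans (signavg_le _ _ pw)); rewrite signavg_affine.
rewrite mulrDl mul1r [leRHS]addrC lerD2r.
apply: (@le_trans _ _ (c / S ^+ m * (mom m ^+ m * S ^+ m))).
  by rewrite ler_pM2l// divr_gt0// exprn_gt0.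
by rewrite mulrCA divfK ?gt_eqF ?exprn_gt0//.
Qed.

(** The pointwise form of the fact that [L^r] has type [min r 2]: with
    [t = type_exponent r], the coefficients [w `^ t^-1] put [\sum w |y|^r] on
    the right for both ranges of [r], which is then integrated termwise. *)
Lemma signavg_type (r : R) (I : Type) (s : seq I) (w : I -> R) (y : I -> F) :
  1 <= r -> (forall i, 0 <= w i) -> \sum_(i <- s) w i <= 1 ->
  signavg (fun z => M z `^ r)
    [seq ofR k (w i `^ (type_exponent r)^-1) * y i | i <- s] 0
  <= type_const r * \sum_(i <- s) w i * M (y i) `^ r.
Proof.
move=> r1 w0 W1; rewrite /type_exponent.
have C1 := type_const_ge1 r; have rn0 : r != 0 by lra.
have [r2|r2] := leP r 2.
  apply: (le_trans (signavg_clarkson _ _ _)); first by rewrite r1.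
  rewrite modulus0 powR0// add0r.
  rewrite big_map.
  have -> : \sum_(j <- s) M (ofR k (w j `^ r^-1) * y j) `^ r
          = \sum_(i <- s) w i * M (y i) `^ r.
    apply: eq_bigr => i _; rewrite modulusM modulus_ofR ger0_norm ?powR_ge0//.
    rewrite powRM ?powR_ge0 ?modulus_ge0// -powRrM mulVf// powRr1//.
  rewrite ler_peMl// sumr_ge0// => i _; by rewrite mulr_ge0// powR_ge0.
apply: (le_trans (signavg_ge2 _ (ltW r2))).
rewrite ler_wpM2l ?(le_trans _ C1)// big_map.
have -> : \sum_(j <- s) M (ofR k (w j `^ 2^-1) * y j) ^+ 2
        = \sum_(i <- s) w i * M (y i) ^+ 2.
  apply: eq_bigr => i _; rewrite modulusM modulus_ofR ger0_norm ?powR_ge0//.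
  by rewrite exprMn -(powR_mulrn 2 (powR_ge0 _ _)) -powRrM mulVf// powRr1.
apply: (le_trans (powR_jensen _ _ _ _)) => //; first by move=> i; exact: sqr_ge0.
  by lra.
apply: ler_sum => i _; rewrite ler_wpM2l// -powR_mulrn ?modulus_ge0// -powRrM.
by rewrite le_eqVlt; apply/orP; left; apply/eqP; congr (_ `^ _); field.
Qed.

Definition khintchine_const (g : R) : R := 2 * (2 * mom 2 ^+ 2) `^ (1 - g / 2).

(** Khintchine's lower bound, from the second and fourth moments:
    [Y `^ (g/2) * L `^ (1 - g/2) >= Y - Y^2 / L] for every threshold [L]. *)
Lemma khintchine_lower (g : R) (s : seq F) : 0 < g <= 2 ->
  (\sum_(z <- s) M z ^+ 2) `^ (g / 2)
  <= khintchine_const g * signavg (fun z => M z `^ g) s 0.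
Proof.
move=> /andP[g0 g2]; set S := \sum_(z <- s) _.
have rad0 : 0 <= signavg (fun z => M z `^ g) s 0.
  by apply: signavg_ge0 => u; exact: powR_ge0.
have S0 : 0 <= S by rewrite sumr_ge0// => i _; exact: sqr_ge0.
have [SE|Sn0] := eqVneq S 0.
  rewrite SE powR0 ?gt_eqF ?divr_gt0//.
  by rewrite !mulr_ge0// powR_ge0.
have {Sn0 S0} S0 : 0 < S by rewrite lt_neqAle eq_sym Sn0.
have H := @signavg_even_moment R k s 0 0 2 isT (lexx _).
rewrite modulus0 expr0n/= add0r addr0 -/S in H.
have K1 := @mom_ge1 R 2; set K := mom 2 in H K1 *.
have K0 : 0 < K by lra.
have [L LE] : exists L, L = 2 * K ^+ 2 * S by eexists.
have L0 : 0 < L by rewrite LE !mulr_gt0// exprn_gt0.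
set e := L `^ (1 - g / 2).
have e0 : 0 < e by rewrite powR_gt0.
have aux Y : 0 <= Y -> Y <= e * Y `^ (g / 2) + L^-1 * Y ^+ 2.
  move=> Y0; have [YL|YL] := leP Y L; last first.
    rewrite (le_trans (_ : _ <= L^-1 * Y ^+ 2)) ?lerDr ?mulr_ge0 ?powR_ge0 ?(ltW e0)//.
    by rewrite expr2 mulrA ler_peMl// mulrC ler_pdivlMr// mul1r ltW.
  rewrite (le_trans (_ : _ <= e * Y `^ (g / 2))) ?lerDl ?mulr_ge0 ?sqr_ge0 ?invr_ge0 ?(ltW L0)//.
  have [->|Yn0] := eqVneq Y 0; first by rewrite mulr_ge0 ?powR_ge0// ltW.
  rewrite [leLHS](_ : Y = Y `^ (1 - g / 2) * Y `^ (g / 2)); last by rewrite -powRD ?Yn0 ?implybT// subrK powRr1.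
  by rewrite ler_wpM2r ?powR_ge0// ge0_ler_powR ?nnegrE ?(ltW L0)//; lra.
have pw z : M z ^+ 2 <= e * M z `^ g + (L^-1 * (M z ^+ 2 + 0) ^+ 2 + 0).
  rewrite !addr0; have -> : M z `^ g = (M z ^+ 2) `^ (g / 2).
    by rewrite -powR_mulrn ?modulus_ge0// -powRrM; congr (_ `^ _); field.
  exact/aux/sqr_ge0.
have := signavg_le s 0 pw; rewrite signavg_sqr modulus0 expr0n/= add0r -/S.
rewrite signavgD signavg_affine addr0.
have -> : signavg (fun u => e * M u `^ g) s 0 = e * signavg (fun u => M u `^ g) s 0.
  rewrite -[RHS]addr0 -signavg_affine; congr (signavg _ _ _).
  by apply/funext => u; rewrite addr0.
have h1 : L^-1 * signavg (fun z => (M z ^+ 2 + 0) ^+ 2) s 0 <= S / 2.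
  apply: (@le_trans _ _ (L^-1 * (K * S) ^+ 2)).
    by rewrite ler_pM2l ?invr_gt0.
  rewrite le_eqVlt; apply/orP; left; apply/eqP; rewrite LE; field.
  by rewrite !gt_eqF.
move=> h2.
have h3 : S <= 2 * (e * signavg (fun u => M u `^ g) s 0) by lra.
have Se : S = S `^ (g / 2) * S `^ (1 - g / 2).
  by rewrite -powRD ?(gt_eqF S0) ?implybT// subrKC powRr1// ltW.
have s0 : 0 < S `^ (1 - g / 2) by rewrite powR_gt0.
rewrite -(ler_pM2r s0) -Se (le_trans h3)// /e LE powRM ?(ltW S0)//; last first.
  by rewrite !mulr_ge0// ?exprn_ge0 ltW.
by rewrite le_eqVlt; apply/orP; left; apply/eqP; rewrite /khintchine_const; ring.
Qed.

End TypeAndCotype.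
(** * Integrals of nonnegative real-valued functions *)

Section NonnegIntegrals.
Context {R : realType} {d : measure_display} {X : measurableType d}.
Variable mu : {measure set X -> \bar R}.
Implicit Types (f g : X -> R) (c : R).

Lemma integral_EFin_le f g :
  measurable_fun setT f -> measurable_fun setT g ->
  (forall x, 0 <= f x) -> (forall x, 0 <= g x) ->
  {ae mu, forall x, f x <= g x} ->
  (\int[mu]_x (f x)%:E <= \int[mu]_x (g x)%:E)%E.
Proof.
move=> mf mg f0 g0 fg; apply: ae_ge0_le_integral => //.
- by move=> x _; rewrite lee_fin.
- exact/measurable_EFinP.
- by move=> x _; rewrite lee_fin.
- exact/measurable_EFinP.
- by apply: filterS fg => x h _; rewrite lee_fin.
Qed.

Lemma integral_EFinD f g :
  measurable_fun setT f -> measurable_fun setT g ->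
  (forall x, 0 <= f x) -> (forall x, 0 <= g x) ->
  (\int[mu]_x (f x + g x)%:E = \int[mu]_x (f x)%:E + \int[mu]_x (g x)%:E)%E.
Proof.
move=> mf mg f0 g0; under eq_integral do rewrite EFinD.
rewrite ge0_integralD//.
- by move=> x _; rewrite lee_fin.
- exact/measurable_EFinP.
- by move=> x _; rewrite lee_fin.
- exact/measurable_EFinP.
Qed.

Lemma integral_EFinZ c f :
  measurable_fun setT f -> (forall x, 0 <= f x) -> 0 <= c ->
  (\int[mu]_x (c * f x)%:E = c%:E * \int[mu]_x (f x)%:E)%E.
Proof.
move=> mf f0 c0; under eq_integral do rewrite EFinM.
rewrite ge0_integralZl_EFin//.
- by move=> x _; rewrite lee_fin.
- exact/measurable_EFinP.
Qed.

Lemma integral_EFin_sum (I : Type) (s : seq I) (F : I -> X -> R) :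
  (forall i, measurable_fun setT (F i)) -> (forall i x, 0 <= F i x) ->
  (\int[mu]_x (\sum_(i <- s) F i x)%:E = \sum_(i <- s) \int[mu]_x (F i x)%:E)%E.
Proof.
move=> mF F0; under eq_integral do rewrite -sumEFin.
rewrite ge0_integral_sum//.
- by move=> i; exact/measurable_EFinP.
- by move=> i x _; rewrite lee_fin.
Qed.

End NonnegIntegrals.

Lemma measurable_powRl (R : realType) (d : measure_display)
    (X : measurableType d) (f : X -> R) (a : R) :
  measurable_fun setT f -> measurable_fun setT (fun x => f x `^ a).
Proof. by move=> mf; exact: (measurableT_comp (measurable_powR a) mf). Qed.

(** * Measurable scalar functions *)

Section ScalarMeasurable.
Context {R : realType} {k : scalar_kind}.
Local Notation F := (scalar_field R k).
Local Notation M := (@modulus R k).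
Context {d : measure_display} {X : measurableType d}.
Implicit Types (u v : X -> F).

Lemma scalar_measurable_axpy (a : F) u v :
  scalar_measurable u -> scalar_measurable v ->
  scalar_measurable (fun x => a * u x + v x).
Proof.
case: k a u v => [a u v mu mv|[a b] u v [mu1 mu2] [mv1 mv2]] /=.
  by apply: measurable_funD => //; exact: measurable_funM.
split.
  rewrite (_ : _ \o _ = fun x => a * (@complex.Re R \o u) x
    - b * (@complex.Im R \o u) x + (@complex.Re R \o v) x); last first.
    by apply/funext => x /=; case: (u x) => ? ?; case: (v x).
  by apply: measurable_funD => //; apply: measurable_funB; exact: measurable_funM.
rewrite (_ : _ \o _ = fun x => a * (@complex.Im R \o u) x
    + b * (@complex.Re R \o u) x + (@complex.Im R \o v) x); last first.
  by apply/funext => x /=; case: (u x) => ? ?; case: (v x).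
by apply: measurable_funD => //; apply: measurable_funD; exact: measurable_funM.
Qed.

Lemma scalar_measurable0 : scalar_measurable (fun _ : X => 0 : F).
Proof. by case: k => /=; [|split]; exact: measurable_cst. Qed.

Lemma scalar_measurableD u v :
  scalar_measurable u -> scalar_measurable v ->
  scalar_measurable (fun x => u x + v x).
Proof.
move=> mu mv; rewrite (_ : (fun x => _) = fun x => 1 * u x + v x).
  exact: scalar_measurable_axpy.
by apply/funext => x; rewrite mul1r.
Qed.

Lemma scalar_measurableB u v :
  scalar_measurable u -> scalar_measurable v ->
  scalar_measurable (fun x => u x - v x).
Proof.
move=> mu mv; rewrite (_ : (fun x => _) = fun x => -1 * v x + u x).
  exact: scalar_measurable_axpy.
by apply/funext => x; rewrite mulN1r addrC.
Qed.

Lemma scalar_measurableZ (a : F) u :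
  scalar_measurable u -> scalar_measurable (fun x => a * u x).
Proof.
move=> mu; rewrite (_ : (fun x => _) = fun x => a * u x + 0).
  by apply: scalar_measurable_axpy => //; exact: scalar_measurable0.
by apply/funext => x; rewrite addr0.
Qed.

Lemma measurable_modulus u :
  scalar_measurable u -> measurable_fun setT (fun x => M (u x)).
Proof.
case: k u => [u mu|u [mu1 mu2]] /=; first exact: measurableT_comp.
rewrite (_ : (fun x => _) = fun x => ((@complex.Re R \o u) x ^+ 2
   + (@complex.Im R \o u) x ^+ 2) `^ 2^-1); last first.
  apply/funext => x /=; case: (u x) => a b /=.
  by rewrite powR12_sqrt// addr_ge0// sqr_ge0.
by apply: measurable_powRl; apply: measurable_funD; exact: measurable_funX.
Qed.

Lemma measurable_signavg (G : F -> R) (I : Type) (s : seq I) (v : I -> X -> F)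
    u :
  (forall u, scalar_measurable u -> measurable_fun setT (fun x => G (u x))) ->
  (forall i, scalar_measurable (v i)) -> scalar_measurable u ->
  measurable_fun setT (fun x => signavg G [seq v i x | i <- s] (u x)).
Proof.
move=> mG mv; elim: s u => [|i s ih] u mu /=; first exact: mG.
under eq_fun do rewrite mulrC.
apply: measurable_funM; first exact: measurable_cst.
apply: measurable_funD.
- by apply: (ih (fun x => u x + v i x)); exact: scalar_measurableD.
- by apply: (ih (fun x => u x - v i x)); exact: scalar_measurableB.
Qed.

Lemma measurable_signavg_powR (g : R) (I : Type) (s : seq I) (v : I -> X -> F)
    u :
  (forall i, scalar_measurable (v i)) -> scalar_measurable u ->
  measurable_fun setT
    (fun x => signavg (fun z => M z `^ g) [seq v i x | i <- s] (u x)).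
Proof.
apply: measurable_signavg => {}u mu.
by apply: measurable_powRl; exact: measurable_modulus.
Qed.

End ScalarMeasurable.

(** * Simple functions with finite [L^r] norm *)

Section SimpleFunctions.
Context {R : realType} {k : scalar_kind}.
Local Notation F := (scalar_field R k).
Local Notation M := (@modulus R k).
Context {dY : measure_display} {Y : measurableType dY}.
Variable nu : {measure set Y -> \bar R}.
Variable r : R.
Hypothesis r1 : 1 <= r.
Implicit Types (f g : Y -> F).

Let r0 : 0 < r. Proof. by apply: lt_le_trans r1. Qed.
Let rn0 : r != 0. Proof. by rewrite gt_eqF. Qed.

Lemma Lr_norm_powR f :
  (Lr_norm nu r f `^ r = \int[nu]_y (M (f y) `^ r)%:E)%E.
Proof.
rewrite /Lr_norm (poweR_Lnorm _ _ rn0); apply: eq_integral => y _ /=.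
by rewrite ger0_norm ?modulus_ge0// poweR_EFin.
Qed.

Definition rnorm f : R := fine (Lr_norm nu r f).

Lemma rnorm_ge0 f : 0 <= rnorm f.
Proof. by rewrite fine_ge0//; exact: Lnorm_ge0. Qed.

Lemma rnormE f : simple_Lr nu r f -> ((rnorm f)%:E = Lr_norm nu r f)%E.
Proof.
move=> [_ _ fy]; rewrite fineK// ge0_fin_numE//; exact: Lnorm_ge0.
Qed.

Lemma rnorm_powR f : simple_Lr nu r f ->
  ((rnorm f `^ r)%:E = \int[nu]_y (M (f y) `^ r)%:E)%E.
Proof. by move=> Df; rewrite -Lr_norm_powR -rnormE. Qed.

Lemma simple_LrP f : scalar_measurable f -> finite_set (range f) ->
  (\int[nu]_y (M (f y) `^ r)%:E < +oo)%E -> simple_Lr nu r f.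
Proof.
move=> mf ff; rewrite -Lr_norm_powR => h; split => //.
exact: lty_poweRy h.
Qed.

Lemma simple_Lr_axpy (a : F) f g : simple_Lr nu r f -> simple_Lr nu r g ->
  simple_Lr nu r (fun y => a * f y + g y).
Proof.
move=> Df Dg; have [mf ff _] := Df; have [mg fg _] := Dg.
have mh := scalar_measurable_axpy a mf mg.
apply: simple_LrP => //.
  apply: (sub_finite_set _ (finite_image2 (fun u v => a * u + v) ff fg)).
  by move=> _ [y _ <-]; exists (f y); [exists y|exists (g y); [exists y|]].
have mp u : scalar_measurable u -> measurable_fun setT (fun y => M (u y) `^ r).
  by move=> mu; apply: measurable_powRl; exact: measurable_modulus.
pose c := M a `^ r.
have c0 : 0 <= c by exact: powR_ge0.
have p0 u y : 0 <= M (u y : F) `^ r by exact: powR_ge0.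
have C0 : 0 <= 2 `^ r :> R by exact: powR_ge0.
apply: (@le_lt_trans _ _
    (\int[nu]_y (2 `^ r * (c * M (f y) `^ r + M (g y) `^ r))%:E)%E).
  apply: integral_EFin_le => //.
  - exact: mp.
  - apply: measurable_funM; first exact: measurable_cst.
    apply: measurable_funD; last exact: mp.
    by apply: measurable_funM; [exact: measurable_cst|exact: mp].
  - by move=> y; rewrite mulr_ge0// addr_ge0// mulr_ge0.
  apply: nearW => y; rewrite /c -powRM ?modulus_ge0// -modulusM.
  set A := a * f y; set B := g y.
  have [AB|AB] := leP (M A) (M B).
    apply: (@le_trans _ _ ((2 * M B) `^ r)).
      rewrite ge0_ler_powR ?nnegrE ?mulr_ge0 ?modulus_ge0// ?(ltW r0)//.
      by have := modulusD A B; lra.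
    by rewrite powRM ?modulus_ge0//; apply: ler_wpM2l => //; rewrite lerDr powR_ge0.
  apply: (@le_trans _ _ ((2 * M A) `^ r)).
    rewrite ge0_ler_powR ?nnegrE ?mulr_ge0 ?modulus_ge0// ?(ltW r0)//.
    by have := modulusD A B; lra.
  by rewrite powRM ?modulus_ge0//; apply: ler_wpM2l => //; rewrite lerDl powR_ge0.
have mcf : measurable_fun setT (fun y => c * M (f y) `^ r).
  by apply: measurable_funM; [exact: measurable_cst|exact: mp].
rewrite integral_EFinZ//; last 2 first.
- by apply: measurable_funD => //; exact: mp.
- by move=> y; rewrite addr_ge0// mulr_ge0.
rewrite integral_EFinD//; last 2 first.
- exact: mp.
- by move=> y; rewrite mulr_ge0.
rewrite integral_EFinZ//; last exact: mp.
by rewrite -!rnorm_powR// -!EFinM ltry.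
Qed.

Lemma simple_Lr0 : simple_Lr nu r (fun=> 0 : F).
Proof.
apply: simple_LrP; first exact: scalar_measurable0.
- apply: (sub_finite_set _ (finite_set1 (0 : F))).
  by move=> _ [y _ <-].
- by under eq_integral do rewrite modulus0 powR0//; rewrite integral0.
Qed.

Lemma simple_LrZ (a : F) f : simple_Lr nu r f ->
  simple_Lr nu r (fun y => a * f y).
Proof.
move=> Df; rewrite (_ : (fun y => _) = fun y => a * f y + 0).
  by apply: simple_Lr_axpy => //; exact: simple_Lr0.
by apply/funext => x; rewrite addr0.
Qed.

Lemma simple_LrD f g : simple_Lr nu r f -> simple_Lr nu r g ->
  simple_Lr nu r (f + g).
Proof.
move=> Df Dg; rewrite (_ : f + g = fun y => 1 * f y + g y).
  exact: simple_Lr_axpy.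
by apply/funext => y; rewrite mul1r.
Qed.

Lemma simple_LrB f g : simple_Lr nu r f -> simple_Lr nu r g ->
  simple_Lr nu r (f - g).
Proof.
move=> Df Dg; rewrite (_ : f - g = fun y => -1 * g y + f y).
  exact: simple_Lr_axpy.
by apply/funext => y; rewrite mulN1r addrC.
Qed.

Lemma rnormZ (a : F) f : simple_Lr nu r f ->
  rnorm (fun y => a * f y) = M a * rnorm f.
Proof.
move=> Df; have Daf := simple_LrZ a Df.
apply: (powR_injective r0); rewrite ?nnegrE ?mulr_ge0 ?rnorm_ge0 ?modulus_ge0//.
apply: EFin_inj; rewrite powRM ?rnorm_ge0 ?modulus_ge0// EFinM !rnorm_powR//.
rewrite -integral_EFinZ ?powR_ge0//.
- by apply: eq_integral => y _; rewrite modulusM powRM ?modulus_ge0.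
- by case: Df => mf _ _; apply: measurable_powRl; exact: measurable_modulus.
- by move=> y; exact: powR_ge0.
Qed.

Lemma signavg_rnorm_powR (I : Type) (s : seq I) (f : I -> Y -> F) g :
  (forall i, simple_Lr nu r (f i)) -> simple_Lr nu r g ->
  ((signavg (fun f => rnorm f `^ r) [seq f i | i <- s] g)%:E
   = \int[nu]_y (signavg (fun z => M z `^ r) [seq f i y | i <- s] (g y))%:E)%E.
Proof.
move=> Df; elim: s g => [|i s ih] g Dg; first by rewrite /= rnorm_powR.
have sm h : simple_Lr nu r h -> measurable_fun setT
    (fun y => signavg (fun z => M z `^ r) [seq f i y | i <- s] (h y)).
  by move=> [mh _ _]; apply: measurable_signavg_powR => // j; case: (Df j).
have s0 h y : 0 <= signavg (fun z => M z `^ r) [seq f i y | i <- s] (h : F).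
  by apply: signavg_ge0 => u; exact: powR_ge0.
have Dp : simple_Lr nu r (g + f i) by exact: simple_LrD.
have Dm : simple_Lr nu r (g - f i) by exact: simple_LrB.
rewrite /= mulrC EFinM EFinD !ih//.
rewrite -integral_EFinD//; [|exact: sm..].
rewrite -integral_EFinZ//.
- by apply: eq_integral => y _; rewrite mulrC.
- by apply: measurable_funD; exact: sm.
- by move=> y; rewrite addr_ge0.
Qed.

End SimpleFunctions.
(** * The vector-valued inequality for one operator *)

Section Sampling.
Context {R : realType} {I : finType}.
Variable w : I -> R.
Hypothesis w0 : forall i, 0 <= w i.
Hypothesis w1 : \sum_i w i = 1.

(** The expectation of [G] over [n] independent indices of law [w], prepended
    to [s]. *)
Fixpoint sampleavg (G : seq I -> R) n s : R :=
  if n is n'.+1 then \sum_i w i * sampleavg G n' (i :: s) else G s.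

Lemma sampleavg_ge0 (G : seq I -> R) n s :
  (forall s, 0 <= G s) -> 0 <= sampleavg G n s.
Proof.
move=> G0; elim: n s => [|n ih] s //=.
by apply: sumr_ge0 => i _; rewrite mulr_ge0.
Qed.

Lemma sampleavg_hit (P : pred I) (a : R) (G : seq I -> R) n s : 0 <= a ->
  (forall s, 0 <= G s) -> (forall s, has P s -> a <= G s) ->
  a * (1 - (1 - \sum_(i | P i) w i) ^+ n) <= sampleavg G n s.
Proof.
move=> a0 G0 Ga; set W := \sum_(i | P i) w i.
have hit m t : has P t -> a <= sampleavg G m t.
  elim: m t => [|m ih] t Pt /=; first exact: Ga.
  rewrite -[leLHS]mul1r -w1 mulr_suml; apply: ler_sum => i _.
  by rewrite ler_wpM2l// ih//= Pt orbT.
elim: n s => [|n ih] s /=; first by rewrite expr0 subrr mulr0.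
set c := a * (1 - (1 - W) ^+ n).
have nW : \sum_(i | ~~ P i) w i = 1 - W by have := w1; rewrite (bigID P)/= -/W; lra.
have -> : a * (1 - (1 - W) ^+ n.+1) = W * a + (1 - W) * c.
  by rewrite /c exprS; ring.
rewrite (bigID P)/= -nW !mulr_suml; apply: lerD; apply: ler_sum => i Pi.
  by rewrite ler_wpM2l// hit//= Pi.
by rewrite ler_wpM2l.
Qed.

Lemma bernoulli_ge (x : R) n : 0 <= x -> 1 + n%:R * x <= (1 + x) ^+ n.
Proof.
move=> x0; elim: n => [|n ih]; first by rewrite expr0 mul0r addr0.
rewrite exprS -natr1; apply: (@le_trans _ _ ((1 + x) * (1 + n%:R * x))).
  have : 0 <= n%:R * x * x by rewrite !mulr_ge0.
  lra.
by rewrite ler_wpM2l//; lra.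
Qed.

Lemma expr_half (W : R) n : 0 <= W <= 1 -> 1 <= n%:R * W ->
  (1 - W) ^+ n <= 2^-1.
Proof.
move=> /andP[W0 W1] nW.
have h2 : 2 <= (1 + W) ^+ n by rewrite (le_trans _ (bernoulli_ge n W0))//; lra.
have h0 : 0 <= (1 - W) ^+ n by rewrite exprn_ge0// subr_ge0.
have : (1 - W) ^+ n * (1 + W) ^+ n <= 1.
  rewrite -exprMn exprn_ile1//; nra.
have := ler_wpM2l h0 h2; lra.
Qed.

(** [n] independent samples miss a set of mass at least [1/n] with probability
    at most [(1 - 1/n)^n <= 1/2]. *)
Lemma sampleavg_hit_half (P : pred I) (a : R) (G : seq I -> R) n s : 0 <= a ->
  (forall s, 0 <= G s) -> (forall s, has P s -> a <= G s) ->
  1 <= n%:R * \sum_(i | P i) w i ->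
  a <= 2 * sampleavg G n s.
Proof.
move=> a0 G0 Ga nW; have := sampleavg_hit n s a0 G0 Ga.
have W01 : 0 <= \sum_(i | P i) w i <= 1.
  rewrite sumr_ge0//=; have := w1; rewrite (bigID P)/=.
  have : 0 <= \sum_(i | ~~ P i) w i by rewrite sumr_ge0.
  lra.
have := ler_wpM2l a0 (expr_half W01 nW); lra.
Qed.

(** Summing the distribution function over dyadic masses. The thresholds
    [4 e l] bound the values that [B] exceeds on a set of mass [2^-l]; the
    points of mass zero are invisible to the sum, so finitely many levels
    suffice. *)
Lemma weighted_sum_le_dyadic (B : I -> R) (e : nat -> R) (th : R) n :
  0 < th <= 1 -> (forall i, 0 <= B i) -> (forall l, 0 <= e l) ->
  (forall l a, 0 <= a -> 1 <= 2 ^+ l * \sum_(i | a <= B i) w i ->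
     a <= 4 * e l) ->
  (forall i, w i != 0 -> 1 <= 2 ^+ n * w i) ->
  (\sum_i w i * B i `^ th^-1) `^ th
  <= 4 * (e 0%N + \sum_(l < n) e l.+1 * (2 ^- l) `^ th).
Proof.
move=> th01 B0 e0 He wn; have /andP[th0 th1] := th01.
have thn0 : th != 0 by rewrite gt_eqF.
set q := th^-1; have q0 : 0 < q by rewrite invr_gt0.
pose D := 1 + \sum_(l < n) ((2 ^- l) `^ th : R).
have D1 : 1 <= D by rewrite /D lerDl sumr_ge0// => l _; exact: powR_ge0.
apply/ler_addgt0Pr => eps eps0.
have [eta etaE] : exists eta, eta = eps / D by eexists.
have eta0 : 0 < eta by rewrite etaE divr_gt0//; lra.
pose c l := 4 * e l + eta.
have c0 l : 0 <= c l by rewrite addr_ge0 ?mulr_ge0// ltW.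
have tail l : \sum_(i | c l <= B i) w i <= 2 ^- l.
  rewrite leNgt; apply/negP => h.
  suff : c l <= 4 * e l by rewrite /c; lra.
  apply: He (c0 l) _.
  by rewrite mulrC -ler_pdivrMr ?exprn_gt0// mul1r ltW.
have pq x y : 0 <= x -> x <= y -> x `^ q <= y `^ q.
  by move=> x0 xy; rewrite ge0_ler_powR ?nnegrE ?(ltW q0)// (le_trans x0).
have layer i : B i `^ q <= c 0%N `^ q
    + \sum_(l < n) c l.+1 `^ q * (c l <= B i)%R%:R + B i `^ q * (c n <= B i)%R%:R.
  elim: n {wn D D1 etaE} => [|m ih].
    rewrite big_ord0 addr0; case: (leP (c 0%N) (B i)) => /= h.
      by rewrite mulr1 lerDr powR_ge0.
    by rewrite mulr0 addr0 pq// ltW.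
  apply: (le_trans ih); rewrite big_ord_recr/= !addrA -!addrA lerD2l lerD2l.
  case: (leP (c m) (B i)) => /= h.
    rewrite !mulr1; case: (leP (c m.+1) (B i)) => /= h'; first by rewrite mulr1 lerDr powR_ge0.
    by rewrite mulr0 addr0 pq// ltW.
  by rewrite !mulr0 add0r mulr_ge0 ?powR_ge0.
have last0 i : w i * (B i `^ q * (c n <= B i)%R%:R) = 0.
  have [->|wi0] := eqVneq (w i) 0; first by rewrite mul0r.
  case: (leP (c n) (B i)) => /= h; last by rewrite !mulr0.
  exfalso; suff : c n <= 4 * e n by rewrite /c; lra.
  apply: He (c0 n) _.
  rewrite (le_trans (wn _ wi0))// ler_wpM2l ?exprn_ge0//.
  by rewrite (bigD1 i)//= lerDl sumr_ge0.
have total : \sum_i w i * B i `^ q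
    <= c 0%N `^ q + \sum_(l < n) c l.+1 `^ q * 2 ^- l.
  apply: (@le_trans _ _ (\sum_i (w i * c 0%N `^ q
      + \sum_(l < n) c l.+1 `^ q * (w i * (c l <= B i)%R%:R)))).
    apply: ler_sum => i _; have := ler_wpM2l (w0 i) (layer i).
    rewrite !mulrDr last0 addr0 mulr_sumr => /le_trans; apply.
    by rewrite lerD2l; apply: ler_sum => l _; rewrite mulrCA.
  rewrite big_split/= -mulr_suml w1 mul1r lerD2l exchange_big/=.
  apply: ler_sum => l _; rewrite -mulr_sumr ler_wpM2l ?powR_ge0//.
  rewrite (le_trans _ (tail l))// [leRHS]big_mkcond/=; apply: ler_sum => i _.
  by case: ifP => _; rewrite ?mulr1 ?mulr0.
have qK x : 0 <= x -> (x `^ q) `^ th = x.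
  by move=> x0; rewrite -powRrM /q mulVf// powRr1.
apply: (@le_trans _ _ ((c 0%N `^ q
    + \sum_(l < n) c l.+1 `^ q * 2 ^- l) `^ th)).
  rewrite ge0_ler_powR ?nnegrE ?(ltW th0)//.
    by apply: sumr_ge0 => i _; rewrite mulr_ge0 ?powR_ge0.
  rewrite addr_ge0 ?powR_ge0// sumr_ge0// => l _.
  by rewrite mulr_ge0 ?powR_ge0// invr_ge0 exprn_ge0.
have s0 (l : 'I_n) : 0 <= c l.+1 `^ q * 2 ^- l.
  by rewrite mulr_ge0 ?powR_ge0// invr_ge0 exprn_ge0.
apply: (le_trans (powRD_le (powR_ge0 _ _) _ th01)); first by rewrite sumr_ge0.
apply: (le_trans (lerD (lexx _) (powR_sum_le _ s0 th01))).
rewrite qK//.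
have -> : eps = eta * D by rewrite etaE divfK// gt_eqF//; lra.
rewrite /D [leRHS](_ : _ = c 0%N + (4 * (\sum_(l < n) e l.+1 * (2 ^- l) `^ th)
    + eta * \sum_(l < n) ((2 ^- l) `^ th : R))); last by rewrite /c; ring.
rewrite lerD2l !mulr_sumr -big_split/=; apply: ler_sum => l _.
by rewrite powRM ?powR_ge0 ?invr_ge0 ?exprn_ge0// qK// mulrA -mulrDl.
Qed.

End Sampling.
Section OneOperator.
Context {R : realType} {k : scalar_kind}.
Local Notation F := (scalar_field R k).
Local Notation M := (@modulus R k).
Context {dX : measure_display} {X : measurableType dX}.
Variable mu : {measure set X -> \bar R}.
Context {dY : measure_display} {Y : measurableType dY}.
Variables (nu : {measure set Y -> \bar R}) (r : R).
Hypothesis r1 : 1 <= r.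
Local Notation D := (@simple_Lr R k dY Y nu r).
Local Notation N := (@rnorm R k dY Y nu r).
Variable T : (Y -> F) -> (X -> F).
Hypothesis linT : linear_operator mu D T.
Variables (omega : X -> R) (g B : R).
Hypotheses (momega : measurable_fun setT omega) (omega0 : forall x, 0 <= omega x).
Hypotheses (g0 : 0 < g) (B0 : 0 <= B).
Hypothesis boundT : forall f, D f ->
  (\int[mu]_x (M (T f x) `^ g * omega x)%:E <= (B * N f `^ g)%:E)%E.

Lemma operator_measurable f : D f -> scalar_measurable (T f).
Proof. by case: linT => + _; apply. Qed.

Lemma operatorD f h : D f -> D h ->
  {ae mu, forall x, T (f + h) x = T f x + T h x}.
Proof.
case: linT => _ lin Df Dh; have := lin 1 f h Df Dh.
apply: filterS => x; rewrite mul1r => <-; congr (T _ x).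
by apply/funext => y; rewrite mul1r.
Qed.

Lemma operatorB f h : D f -> D h ->
  {ae mu, forall x, T (f - h) x = T f x - T h x}.
Proof.
case: linT => _ lin Df Dh; have := lin (-1) h f Dh Df.
apply: filterS => x; rewrite mulN1r addrC => <-; congr (T _ x).
by apply/funext => y; rewrite mulN1r addrC.
Qed.

Lemma operator0 : {ae mu, forall x, T (fun=> 0) x = 0}.
Proof.
case: linT => _ lin; have D0 := @simple_Lr0 R k _ _ nu _ r1.
have := lin 1 _ _ D0 D0; apply: filterS => x.
rewrite (_ : (fun y => _) = fun=> 0 :> F); last first.
  by apply/funext => y; rewrite mulr0 addr0.
by rewrite mul1r => h; apply: (@addrI _ (T (fun=> 0) x)); rewrite addr0 -h.
Qed.

Lemma operatorZ (a : F) f : D f ->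
  {ae mu, forall x, T (fun y => a * f y) x = a * T f x}.
Proof.
case: linT => _ lin Df; have D0 := @simple_Lr0 R k _ _ nu _ r1.
have := lin a _ _ Df D0; apply: filterS2 operator0 => x T0.
rewrite T0 addr0 => <-; congr (T _ x).
by apply/funext => y; rewrite addr0.
Qed.

Let mterm (I : Type) (s : seq I) (f : I -> Y -> F) h :
  (forall i, D (f i)) -> D h ->
  measurable_fun setT (fun x => signavg (fun z => M z `^ g)
    [seq T (f i) x | i <- s] (T h x) * omega x).
Proof.
move=> Df Dh; apply: measurable_funM => //.
by apply: (@measurable_signavg_powR _ _ _ _ g _ s (fun i => T (f i)) (T h)) => [i|];
  exact: operator_measurable.
Qed.

Let term0 (s : seq F) z x : 0 <= signavg (fun z => M z `^ g) s z * omega x.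
Proof. by rewrite mulr_ge0// signavg_ge0// => u; exact: powR_ge0. Qed.

(** Linearity moves the average over signs from the values of [T] to its
    arguments. *)
Lemma integral_signavg_le (I : Type) (s : seq I) (f : I -> Y -> F) h :
  (forall i, D (f i)) -> D h ->
  (\int[mu]_x (signavg (fun z => M z `^ g)
      [seq T (f i) x | i <- s] (T h x) * omega x)%:E
   <= (B * signavg (fun f => N f `^ g) [seq f i | i <- s] h)%:E)%E.
Proof.
move=> Df; elim: s h => [|i s ih] h Dh; first exact: boundT.
have Dp : D (h + f i) by exact: simple_LrD.
have Dm : D (h - f i) by exact: simple_LrB.
set a := fun x => signavg (fun z => M z `^ g) [seq T (f i) x | i <- s]
  (T (h + f i) x) * omega x.
set b := fun x => signavg (fun z => M z `^ g) [seq T (f i) x | i <- s]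
  (T (h - f i) x) * omega x.
have ma : measurable_fun setT a by exact: mterm.
have mb : measurable_fun setT b by exact: mterm.
have a0 x : 0 <= a x by exact: term0.
have b0 x : 0 <= b x by exact: term0.
apply: (@le_trans _ _ (\int[mu]_x (2^-1 * (a x + b x))%:E)%E).
  apply: integral_EFin_le => //.
  - exact: (mterm (i :: s)).
  - by apply: measurable_funM; [exact: measurable_cst|exact: measurable_funD].
  - by move=> x; rewrite mulr_ge0// addr_ge0.
  apply: filterS2 (operatorD Dh (Df i)) (operatorB Dh (Df i)) => x Tp Tm.
  by rewrite /a /b Tp Tm /= le_eqVlt; apply/orP; left; apply/eqP; ring.
rewrite integral_EFinZ//; [|exact: measurable_funD|by move=> x; rewrite addr_ge0].
rewrite integral_EFinD// /=.
rewrite [X in (_ <= X%:E)%E](_ : _ = 2^-1 * (B * signavg (fun f => N f `^ g)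
   [seq f i | i <- s] (h + f i) + B * signavg (fun f => N f `^ g)
   [seq f i | i <- s] (h - f i))); last by ring.
rewrite EFinM EFinD lee_pmul2l// ?lte_fin ?invr_gt0//.
by apply: leeD; exact: ih.
Qed.

(** Type [type_exponent r] of [L^r]: a random signed sum of the functions
    [w `^ t^-1 f] has bounded expected norm. *)
Lemma integral_signavg_type (I : finType) (s : seq I) (w : I -> R)
    (f : I -> Y -> F) : g <= r ->
  (forall i, D (f i)) -> (forall i, N (f i) <= 1) -> (forall i, 0 <= w i) ->
  \sum_(i <- s) w i <= 1 ->
  (\int[mu]_x (signavg (fun z => M z `^ g)
      [seq ofR k (w i `^ (type_exponent r)^-1) * T (f i) x | i <- s] 0 * omega x)%:E
   <= (B * (1 + type_const r))%:E)%E.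
Proof.
move=> gr Df Nf w0 W1; set t := type_exponent r.
have r0 : 0 < r by apply: lt_le_trans r1.
pose h i := fun y => ofR k (w i `^ t^-1) * f i y.
have Dh i : D (h i) by exact: simple_LrZ.
have D0 : D (fun=> 0) by exact: simple_Lr0.
apply: (@le_trans _ _ (\int[mu]_x (signavg (fun z => M z `^ g)
      [seq T (h i) x | i <- s] (T (fun=> 0) x) * omega x)%:E)%E).
  apply: integral_EFin_le.
  - apply: measurable_funM => //.
    apply: (@measurable_signavg_powR _ _ _ _ g _ s
      (fun i x => ofR k (w i `^ t^-1) * T (f i) x) (fun=> 0)).
      by move=> i; apply: scalar_measurableZ; exact: operator_measurable.
    exact: scalar_measurable0.
  - exact: mterm.
  - by move=> x; exact: term0.
  - by move=> x; exact: term0.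
  have hZ : {ae mu, forall x, forall i, T (h i) x = ofR k (w i `^ t^-1) * T (f i) x}.
    apply: filter_forall => i; exact: operatorZ.
  apply: filterS2 hZ operator0 => x hx T0; rewrite T0.
  by under [in leRHS]eq_map do rewrite hx.
apply: (le_trans (integral_signavg_le s Dh D0)); rewrite lee_fin ler_wpM2l//.
apply: (@le_trans _ _ (signavg (fun u => 1 * (N u `^ r) + 1) [seq h i | i <- s]
    (fun=> 0))).
  apply: signavg_le => u; rewrite mul1r.
  have [u1|u1] := leP (N u) 1.
    apply: (@le_trans _ _ (1 `^ g)); last by rewrite powR1 lerDr powR_ge0.
    by rewrite ge0_ler_powR ?nnegrE ?(ltW g0)//; exact: rnorm_ge0.
  by rewrite (@le_trans _ _ (N u `^ r)) ?lerDl// ler_powR// ltW.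
rewrite signavg_affine mul1r addrC lerD2l -lee_fin signavg_rnorm_powR//.
have p0 u y : 0 <= M (u y : F) `^ r by exact: powR_ge0.
have mf i : measurable_fun setT (fun y => M (f i y) `^ r).
  by have [mf _ _] := Df i; apply: measurable_powRl; exact: measurable_modulus.
apply: (@le_trans _ _ (\int[nu]_y (type_const r *
    \sum_(i <- s) w i * M (f i y) `^ r)%:E)%E).
  apply: integral_EFin_le.
  - apply: (@measurable_signavg_powR _ _ _ _ r _ s h (fun=> 0)).
      by move=> i; have [] := Dh i.
    exact: scalar_measurable0.
  - apply: measurable_funM; first exact: measurable_cst.
    apply: measurable_sum => i; apply: measurable_funM => //.
  - by move=> y; apply: signavg_ge0 => u; exact: powR_ge0.
  - move=> y; rewrite mulr_ge0 ?(le_trans _ (type_const_ge1 r))// sumr_ge0// => i _.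
    by rewrite mulr_ge0.
  by apply: nearW => y; exact: signavg_type.
rewrite integral_EFinZ ?(le_trans _ (type_const_ge1 r))//; last 2 first.
- by apply: measurable_sum => i; exact: measurable_funM.
- by move=> y; apply: sumr_ge0 => i _; rewrite mulr_ge0.
rewrite integral_EFin_sum; last 2 first.
- by move=> i; exact: measurable_funM.
- by move=> i y; rewrite mulr_ge0.
rewrite -[leRHS]mule1 lee_pmul2l ?lte_fin ?(lt_le_trans _ (type_const_ge1 r))//.
apply: (@le_trans _ _ (\sum_(i <- s) (w i)%:E)%E); last by rewrite sumEFin lee_fin.
apply: lee_sum => i _; rewrite integral_EFinZ// -rnorm_powR//.
rewrite -EFinM lee_fin ler_piMr//.
apply: (@le_trans _ _ (1 `^ r)); last by rewrite powR1.
by rewrite ge0_ler_powR ?nnegrE ?(ltW r0)//; exact: rnorm_ge0.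
Qed.

End OneOperator.
Lemma measurable_sampleavg (R : realType) (d : measure_display)
    (X : measurableType d) (I : finType) (w : I -> R) (G : seq I -> X -> R) n s :
  (forall s, measurable_fun setT (G s)) ->
  measurable_fun setT (fun x => sampleavg w (fun s => G s x) n s).
Proof.
move=> mG; elim: n s => [|n ih] s /=; first exact: mG.
apply: measurable_sum => i; apply: measurable_funM => //.
Qed.

Lemma integral_sampleavg_le (R : realType) (d : measure_display)
    (X : measurableType d) (mu : {measure set X -> \bar R})
    (I : finType) (w : I -> R) (G : seq I -> X -> R) L (C : R) :
  (forall i, 0 <= w i) -> \sum_i w i = 1 ->
  (forall s, measurable_fun setT (G s)) -> (forall s x, 0 <= G s x) ->
  (forall s, size s = L -> (\int[mu]_x (G s x)%:E <= C%:E)%E) ->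
  (\int[mu]_x (sampleavg w (fun s => G s x) L [::])%:E <= C%:E)%E.
Proof.
move=> w0 w1 mG G0 GC.
have ms n s := @measurable_sampleavg R d X I w G n s mG.
have s0 n s x : 0 <= sampleavg w (fun s => G s x) n s by exact: sampleavg_ge0.
suff H n s : (size s + n = L)%N ->
    (\int[mu]_x (sampleavg w (fun s => G s x) n s)%:E <= C%:E)%E by exact: H.
elim: n s => [|n ih] s sL /=; first by apply: GC; rewrite -sL addn0.
rewrite integral_EFin_sum; last 2 first.
- by move=> i; apply: measurable_funM => //; exact: measurable_cst.
- by move=> i x; rewrite mulr_ge0.
have -> : (C%:E = \sum_i (w i * C)%:E)%E by rewrite sumEFin -mulr_suml w1 mul1r.
apply: lee_sum => i _; rewrite integral_EFinZ// EFinM.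
by apply: lee_wpmul2l; [rewrite lee_fin|apply: ih; rewrite /= addSnnS].
Qed.

Lemma powR_exprn (R : realType) (x a : R) n : 0 <= x ->
  (x ^+ n) `^ a = (x `^ a) ^+ n.
Proof.
move=> x0; rewrite -(powR_mulrn n x0) -(powR_mulrn n (powR_ge0 x a)).
by rewrite -!powRrM mulrC.
Qed.

(** The first branch sums the geometric series over dyadic sample sizes; the
    second is the endpoint [p = 2]. *)
Definition vv_const (R : realType) (g r p : R) : R :=
  let t := type_exponent r in let K := 1 + type_const r in
  if p < t then 4 * K * (1 + 2 `^ (g / t) / (1 - 2 `^ (g / t - g / p)))
  else khintchine_const g * K.

Lemma powR2_lt1 (R : realType) (a : R) : a < 0 -> 2 `^ a < 1.
Proof.
move=> a0; rewrite -[a]opprK powRN invf_lt1 ?powR_gt0//.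
apply: (@le_lt_trans _ _ (1 `^ (- a))); first by rewrite powR1.
by rewrite gt0_ltr_powR ?nnegrE//; lra.
Qed.

Lemma vv_const_ratio (R : realType) (g r p : R) : 0 < g -> 0 < p ->
  p < type_exponent r -> 2 `^ (g / type_exponent r - g / p) < 1 :> R.
Proof.
move=> g0 p0 pt; apply: powR2_lt1; rewrite -mulrBr pmulr_rlt0// subr_lt0.
by rewrite ltf_pV2 ?posrE// (lt_trans p0).
Qed.

Lemma vv_const_gt0 (R : realType) (g r p : R) : 0 < g -> 0 < p ->
  0 < vv_const g r p.
Proof.
move=> g0 p0; have K0 : 0 < 1 + type_const r.
  by rewrite addr_gt0// (lt_le_trans _ (type_const_ge1 r)).
rewrite /vv_const; case: ifP => pt; last first.
  rewrite mulr_gt0// /khintchine_const mulr_gt0// powR_gt0// mulr_gt0//.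
  by rewrite exprn_gt0// (lt_le_trans _ (mom_ge1 _)).
rewrite !mulr_gt0// addr_gt0// divr_gt0 ?powR_gt0// subr_gt0.
exact: vv_const_ratio.
Qed.

Lemma geometric_psum_le (R : realType) (q : R) n : 0 <= q < 1 ->
  \sum_(l < n) q ^+ l <= (1 - q)^-1.
Proof.
move=> /andP[q0 q1]; rewrite -[leRHS]mul1r ler_pdivlMr ?subr_gt0//.
have -> : (\sum_(l < n) q ^+ l) * (1 - q) = 1 - q ^+ n.
  elim: n => [|n ih]; first by rewrite big_ord0 expr0; ring.
  by rewrite big_ord_recr/= mulrDl ih exprS; ring.
by rewrite gerBl exprn_ge0.
Qed.

Section VectorValued.
Context {R : realType} {k : scalar_kind}.
Local Notation F := (scalar_field R k).
Local Notation M := (@modulus R k).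
Context {dX : measure_display} {X : measurableType dX}.
Variable mu : {measure set X -> \bar R}.
Context {dY : measure_display} {Y : measurableType dY}.
Variables (nu : {measure set Y -> \bar R}) (r : R).
Hypothesis r1 : 1 <= r.
Local Notation D := (@simple_Lr R k dY Y nu r).
Local Notation N := (@rnorm R k dY Y nu r).
Variable T : (Y -> F) -> (X -> F).
Hypothesis linT : linear_operator mu D T.
Variables (omega : X -> R) (g B : R).
Hypotheses (momega : measurable_fun setT omega) (omega0 : forall x, 0 <= omega x).
Hypotheses (g0 : 0 < g) (B0 : 0 <= B).
Hypothesis boundT : forall f, D f ->
  (\int[mu]_x (M (T f x) `^ g * omega x)%:E <= (B * N f `^ g)%:E)%E.

Variables (I : finType) (w : I -> R) (f : I -> Y -> F).
Hypotheses (Df : forall i, D (f i)) (Nf : forall i, N (f i) <= 1).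
Hypotheses (w0 : forall i, 0 <= w i) (w1 : \sum_i w i = 1).

Let K : R := 1 + type_const r.
Let K0 : 0 < K.
Proof. by rewrite addr_gt0// (lt_le_trans _ (type_const_ge1 r)). Qed.

Let mTf i : scalar_measurable (T (f i)).
Proof. exact: operator_measurable linT _ _. Qed.

Let mS (s : seq I) (c : I -> F) :
  measurable_fun setT (fun x =>
    signavg (fun z => M z `^ g) [seq c i * T (f i) x | i <- s] 0).
Proof.
apply: (@measurable_signavg_powR _ _ _ _ g _ s
  (fun i x => c i * T (f i) x) (fun=> 0)).
  by move=> i; exact: scalar_measurableZ.
exact: scalar_measurable0.
Qed.

(** The endpoint [p = 2], where the signed sums already see the square
    function. *)
Lemma square_function_bound : type_exponent r = 2 -> g <= 2 ->
  (\int[mu]_x ((\sum_i w i * M (T (f i) x) `^ 2) `^ (g / 2) * omega x)%:E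
   <= (B * (khintchine_const g * K))%:E)%E.
Proof.
move=> t2 g2; set kh := khintchine_const g.
have gr : g <= r.
  by rewrite (le_trans g2)// -t2 /type_exponent ge_min lexx.
have kh0 : 0 <= kh by rewrite /kh /khintchine_const mulr_ge0// powR_ge0.
pose S x := signavg (fun z => M z `^ g)
  [seq ofR k (w i `^ 2^-1) * T (f i) x | i <- index_enum I] 0 * omega x.
have mSo : measurable_fun setT S.
  by apply: measurable_funM => //; exact: mS.
have S0 x : 0 <= S x.
  by rewrite mulr_ge0// signavg_ge0// => u; exact: powR_ge0.
apply: (@le_trans _ _ (\int[mu]_x (kh * S x)%:E)%E).
  apply: integral_EFin_le.
  - apply: measurable_funM => //; apply: measurable_powRl.
    apply: measurable_sum => i; apply: measurable_funM => //.
    by apply: measurable_powRl; exact: measurable_modulus.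
  - by apply: measurable_funM => //; exact: measurable_cst.
  - by move=> x; rewrite mulr_ge0// powR_ge0.
  - by move=> x; rewrite mulr_ge0.
  apply: nearW => x; rewrite /S mulrA ler_wpM2r//.
  have -> : \sum_i w i * M (T (f i) x) `^ 2 = \sum_(z <- [seq
      ofR k (w i `^ 2^-1) * T (f i) x | i <- index_enum I]) M z ^+ 2.
    rewrite big_map; apply: eq_bigr => i _.
    rewrite modulusM modulus_ofR ger0_norm ?powR_ge0// exprMn.
    rewrite -(powR_mulrn 2 (powR_ge0 _ _)) -powRrM mulVf// powRr1//.
    by rewrite powR_mulrn// modulus_ge0.
  by apply: khintchine_lower; rewrite g0.
rewrite integral_EFinZ// mulrCA [leRHS]EFinM lee_wpmul2l ?lee_fin//.
have := integral_signavg_type r1 linT momega omega0 g0 B0 boundT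
  (s := index_enum I) gr Df Nf w0.
by rewrite t2 w1; apply.
Qed.

(** The expectation over [2 ^ l] samples; a random sign is given to each sampled
    function, which turns the largest sampled value into a single image of
    [T]. *)
Let E l x := sampleavg w (fun s => signavg (fun z => M z `^ g)
  [seq T (f i) x | i <- s] 0) (2 ^ l) [::].

Let signavg_scale (L : R) (s : seq I) x : 0 < L ->
  signavg (fun z => M z `^ g) [seq T (f i) x | i <- s] 0
  = L `^ (g / type_exponent r) * signavg (fun z => M z `^ g)
     [seq ofR k (L^-1 `^ (type_exponent r)^-1) * T (f i) x | i <- s] 0.
Proof.
move=> L0; set t := type_exponent r; set c := ofR k _.
have -> : [seq c * T (f i) x | i <- s] = [seq c * z | z <- [seq T (f i) x | i <- s]].
  by rewrite -map_comp.
have -> : 0 = c * 0 :> F by rewrite mulr0.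
rewrite (@signavg_map _ _ _ _ _ (fun z => M z `^ g) ((L `^ (g / t))^-1)).
- by rewrite mulr0 mulrA mulfV ?mul1r// gt_eqF// powR_gt0.
- by move=> u v; rewrite mulrDr.
- by move=> u v; rewrite mulrBr.
move=> u; rewrite modulusM powRM ?modulus_ge0//; congr (_ * _).
rewrite /c modulus_ofR ger0_norm ?powR_ge0// -powRrM.
by rewrite -powR_inv1 ?(ltW L0)// -powRrM -powRN; congr (_ `^ _); ring.
Qed.

Let mE0 s : measurable_fun setT (fun x => signavg (fun z => M z `^ g)
  [seq T (f i) x | i <- s] 0).
Proof.
apply: (@measurable_signavg_powR _ _ _ _ g _ s (fun i => T (f i)) (fun=> 0)) => //.
exact: scalar_measurable0.
Qed.

Let E0 l x : 0 <= E l x.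
Proof.
by apply: sampleavg_ge0 => // s; apply: signavg_ge0 => u; exact: powR_ge0.
Qed.

Let mE l : measurable_fun setT (E l).
Proof. exact: measurable_sampleavg. Qed.

(** Each of the [2 ^ l] samples carries weight [2 ^- l]; the type of [L^r] then
    gains over the trivial bound, which would grow like [2 ^+ l]. *)
Lemma sample_bound l : g <= r ->
  (\int[mu]_x (E l x * omega x)%:E
   <= (B * K * (2 `^ (g / type_exponent r)) ^+ l)%:E)%E.
Proof.
move=> gr; set t := type_exponent r; pose L : R := 2 ^+ l.
have L0 : 0 < L by rewrite exprn_gt0.
pose G s x := signavg (fun z => M z `^ g) [seq T (f i) x | i <- s] 0 * omega x.
have -> : (\int[mu]_x (E l x * omega x)%:E
    = \int[mu]_x (sampleavg w (fun s => G s x) (2 ^ l) [::])%:E)%E.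
  apply: eq_integral => x _; congr EFin; rewrite /E.
  elim: (2 ^ l)%N [::] => //= n ih s; rewrite mulr_suml.
  by apply: eq_bigr => i _; rewrite -ih mulrA.
apply: integral_sampleavg_le => //.
- by move=> s; exact: measurable_funM.
- by move=> s x; rewrite mulr_ge0// signavg_ge0// => u; exact: powR_ge0.
move=> s sL.
pose H x := signavg (fun z => M z `^ g)
     [seq ofR k (L^-1 `^ t^-1) * T (f i) x | i <- s] 0 * omega x.
have -> : (\int[mu]_x (G s x)%:E = \int[mu]_x (L `^ (g / t) * H x)%:E)%E.
  by apply: eq_integral => x _; rewrite /G (signavg_scale _ _ L0) mulrA.
rewrite integral_EFinZ ?powR_ge0//; last 2 first.
- by apply: measurable_funM => //; exact: mS.
- by move=> x; rewrite mulr_ge0// signavg_ge0// => u; exact: powR_ge0.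
rewrite powR_exprn// [X in (_ <= X%:E)%E]mulrC [leRHS]EFinM lee_wpmul2l ?lee_fin ?exprn_ge0 ?powR_ge0//.
apply: (integral_signavg_type r1 linT momega omega0 g0 B0 boundT
  (w := fun=> L^-1)) => //.
- by move=> i; rewrite invr_ge0 ltW.
by rewrite big_const_seq count_predT sL iter_addr_0 -mulr_natl natrX mulfV// gt_eqF.
Qed.

Let tail_bound l a x : 0 <= a ->
  1 <= 2 ^+ l * \sum_(i | a <= M (T (f i) x) `^ g) w i -> a <= 4 * E l x.
Proof.
move=> a0 hW; suff : a / 2 <= 2 * E l x by lra.
apply: (@sampleavg_hit_half _ _ _ w0 w1
  (fun i => a <= M (T (f i) x) `^ g) _ _ (2 ^ l)%N [::]).
- by rewrite divr_ge0.
- by move=> s; apply: signavg_ge0 => u; exact: powR_ge0.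
- move=> s /hasP[i si ai].
  have := signavg_ge_coord 0 g0 (map_f (fun i => T (f i) x) si).
  by move: ai => /=; lra.
- by rewrite natrX.
Qed.

(** The dyadic sum has ratio [2 `^ (g / t - g / p) < 1]: the quantile of order
    [2^-l] enters with [2 `^ (- l * g / p)] and costs [2 `^ (l * g / t)]. *)
Lemma power_sum_bound p : 0 < p -> g <= p -> p < type_exponent r ->
  (\int[mu]_x ((\sum_i w i * M (T (f i) x) `^ p) `^ (g / p) * omega x)%:E
   <= (B * vv_const g r p)%:E)%E.
Proof.
move=> p0 gp pt; rewrite /vv_const pt; set t := type_exponent r in pt *.
have gr : g <= r.
  by rewrite (le_trans gp)// (le_trans (ltW pt))// /t /type_exponent ge_min lexx.
set th := g / p.
have th01 : 0 < th <= 1 by rewrite divr_gt0//= ler_pdivrMr// mul1r.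
have [n wn] : exists n, forall i, w i != 0 -> 1 <= 2 ^+ n * w i.
  pose s := \sum_i (w i)^-1.
  have s0 : 0 <= s by apply: sumr_ge0 => i _; rewrite invr_ge0.
  exists (Num.truncn s).+1 => i wi0.
  have wi : 0 < w i by rewrite lt_neqAle eq_sym wi0 w0.
  rewrite -ler_pdivrMr// div1r (@le_trans _ _ s)//.
    by rewrite /s (bigD1 i)//= lerDl sumr_ge0// => j _; rewrite invr_ge0.
  have /andP[_ /ltW h] := truncn_itv s0; rewrite (le_trans h)//.
  by rewrite -natrX ler_nat ltnW// ltn_expl.
pose c l : R := (2 ^- l) `^ th.
have c0 l : 0 <= c l by exact: powR_ge0.
have mEo l : measurable_fun setT (fun x => E l x * omega x).
  exact: measurable_funM.
have Eo0 l x : 0 <= E l x * omega x by rewrite mulr_ge0.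
apply: (@le_trans _ _ (\int[mu]_x (4 * (E 0 x * omega x)
    + \sum_(l < n) (4 * c l) * (E l.+1 x * omega x))%:E)%E).
  apply: integral_EFin_le.
  - apply: measurable_funM => //; apply: measurable_powRl.
    apply: measurable_sum => i; apply: measurable_funM => //.
    by apply: measurable_powRl; exact: measurable_modulus.
  - apply: measurable_funD; first exact: measurable_funM.
    by apply: measurable_sum => l; exact: measurable_funM.
  - by move=> x; rewrite mulr_ge0// powR_ge0.
  - move=> x; rewrite addr_ge0 ?mulr_ge0// sumr_ge0// => l _.
    by rewrite !mulr_ge0.
  apply: nearW => x.
  have := @weighted_sum_le_dyadic _ _ _ w0 w1 (fun i => M (T (f i) x) `^ g)
    (fun l => E l x) th n th01 (fun i => powR_ge0 _ _) (fun l => E0 l x)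
    (fun l a => @tail_bound l a x) wn.
  have -> : \sum_i w i * (M (T (f i) x) `^ g) `^ th^-1
          = \sum_i w i * M (T (f i) x) `^ p.
    apply: eq_bigr => i _; rewrite -powRrM /th invf_div mulrCA mulfV ?mulr1//.
    by rewrite gt_eqF.
  move=> h; apply: (le_trans (ler_wpM2r (omega0 x) h)).
  rewrite mulrDr mulrDl mulrA lerD2l mulr_sumr mulr_suml.
  by apply: ler_sum => l _; rewrite /c le_eqVlt; apply/orP; left; apply/eqP; ring.
rewrite integral_EFinD; last 4 first.
- exact: measurable_funM.
- by apply: measurable_sum => l; exact: measurable_funM.
- by move=> x; rewrite mulr_ge0.
- by move=> x; rewrite sumr_ge0// => l _; rewrite !mulr_ge0.
rewrite integral_EFin_sum; last 2 first.
- by move=> l; exact: measurable_funM.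
- by move=> l x; rewrite !mulr_ge0.
rewrite integral_EFinZ//.
under eq_bigr do rewrite integral_EFinZ ?mulr_ge0//.
set tau := 2 `^ (g / t); set q := 2 `^ (g / t - g / p).
have q01 : 0 <= q < 1 by rewrite powR_ge0/=; exact: vv_const_ratio.
have qE l : c l * tau ^+ l = q ^+ l.
  rewrite /c -exprVn powR_exprn ?invr_ge0// -exprMn; congr (_ ^+ _).
  by rewrite -powR_inv1// -powRrM /tau -powRD ?pnatr_eq0 ?implybT//; congr (_ `^ _); rewrite /th; ring.
apply: (@le_trans _ _ (4%:E * (B * K * tau ^+ 0)%:E
   + \sum_(l < n) (4 * c l)%:E * (B * K * tau ^+ l.+1)%:E)%E).
  apply: leeD; first by rewrite lee_wpmul2l ?lee_fin//; exact: sample_bound.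
  apply: lee_sum => l _; rewrite lee_wpmul2l ?lee_fin ?mulr_ge0//.
  exact: sample_bound.
rewrite -EFinM (eq_bigr (fun l : 'I_n => (4 * B * K * tau * q ^+ l)%:E)); last first.
  by move=> l _; rewrite -EFinM -qE exprS; congr EFin; ring.
rewrite sumEFin -EFinD lee_fin -mulr_sumr expr0 mulr1.
rewrite [leRHS](_ : _ = 4 * (B * K) + 4 * B * K * tau * (1 - q)^-1); last first.
  by rewrite /K; ring.
by rewrite lerD2l ler_wpM2l ?geometric_psum_le// !mulr_ge0 ?powR_ge0 ?(ltW K0).
Qed.

(** The inequality for single functions extends to [p]-sums: by iid sampling
    when [p] is below the type of [L^r], and by Khintchine at the endpoint
    [p = 2]. *)
Lemma vector_valued_bound p : 0 < p -> g <= p ->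
  (r < 2 -> p < r) -> (2 <= r -> p <= 2) ->
  (\int[mu]_x ((\sum_i w i * M (T (f i) x) `^ p) `^ (g / p) * omega x)%:E
   <= (B * vv_const g r p)%:E)%E.
Proof.
move=> p0 gp pr p2.
have [pt|tp] := ltP p (type_exponent r); first exact: power_sum_bound.
have [r2|r2] := ltP r 2.
  have := pr r2; rewrite ltNge => /negP[]; move: tp; rewrite /type_exponent.
  by rewrite min_l// ltW.
have t2 : type_exponent r = 2 by rewrite /type_exponent min_r.
have pE : p = 2 by apply/eqP; rewrite eq_le p2//= -t2.
rewrite /vv_const t2 pE ltxx; apply: square_function_bound => //.
by rewrite -pE.
Qed.

End VectorValued.
(** * Almost everywhere convergence of minimizing sequences *)

Section Weights.
Context {R : realType} {d : measure_display} {X : measurableType d}.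

Lemma ae_lty (mu : {measure set X -> \bar R}) (f : X -> \bar R) :
  measurable_fun setT f -> (forall x, (0 <= f x)%E) ->
  (\int[mu]_x f x < +oo)%E -> {ae mu, forall x, (f x < +oo)%E}.
Proof.
move=> mf f0 fy; have : mu.-integrable setT f.
  by apply/integrableP; split => //; under eq_integral do rewrite gee0_abs//.
move=> /(integrable_ae measurableT); apply: filterS => x /(_ I).
by rewrite ge0_fin_numE.
Qed.

Variable mu : {sigma_finite_measure set X -> \bar R}.

(** A density that makes a sigma-finite measure finite: geometric weights on a
    covering by sets of finite measure. *)
Lemma exists_positive_integrable : exists rho : X -> R,
  [/\ measurable_fun setT rho, forall x, 0 < rho x
    & (\int[mu]_x (rho x)%:E < +oo)%E].
Proof.
have [F FT Ffin] := sigma_finiteT mu.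
have mF n : measurable (F n) by case: (Ffin n).
pose c n : R := (1 + fine (mu (F n)))^-1 * (1 / (2 ^ n.+1)%:R).
have muF0 n : 0 <= fine (mu (F n)) by rewrite fine_ge0.
have h0 n : 0 < 1 / (2 ^ n.+1)%:R :> R by rewrite divr_gt0// ltr0n expn_gt0.
have c0 n : 0 < c n by rewrite mulr_gt0// invr_gt0 ltr_wpDr.
have c1 n : c n <= 1 / (2 ^ n.+1)%:R.
  by rewrite ler_piMl ?(ltW (h0 n))// invf_le1 ?lerDl// ltr_wpDr.
pose f n x := (c n * \1_(F n) x)%:E.
have f0 n x : (0 <= f n x)%E by rewrite lee_fin mulr_ge0// ltW.
have mf n : measurable_fun setT (f n).
  apply/measurable_EFinP; apply: measurable_funM; first exact: measurable_cst.
  exact: measurable_indic.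
pose S x := (\sum_(n <oo) f n x)%E.
have mS : measurable_fun setT S by apply: ge0_emeasurable_sum.
have S0 x : (0 <= S x)%E by exact: nneseries_ge0.
have S1 x : (S x <= 1)%E.
  apply: le_trans (@epsilon_trick0 R 1 xpredT ler01).
  apply: lee_nneseries => // n _; rewrite lee_fin (le_trans _ (c1 n))//.
  by rewrite ler_piMr ?(ltW (c0 n))// indicE; case: (x \in F n).
have Sfin x : S x \is a fin_num.
  by rewrite ge0_fin_numE// (le_lt_trans (S1 x))// ltry.
exists (fine \o S); split.
- by apply: measurableT_comp => //; exact: fine_measurable.
- move=> x; have [n _ Fx] : (\bigcup_i F i) x by rewrite -FT.
  rewrite fine_gt0// (le_lt_trans (S1 x)) ?ltry// andbT.
  apply: (@lt_le_trans _ _ (f n x)).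
    by rewrite lte_fin indicE mem_set// mulr1.
  apply: le_trans (nneseries_lim_ge n.+1 _); last by [].
  by rewrite big_nat_recr//= leeDr// sume_ge0.
- have -> : (\int[mu]_x ((fine \o S) x)%:E = \int[mu]_x S x)%E.
    by apply: eq_integral => x _; rewrite /= fineK.
  rewrite /S integral_nneseries//.
  apply: (@le_lt_trans _ _ 1%E); last exact: ltry.
  apply: le_trans (@epsilon_trick0 R 1 xpredT ler01).
  apply: lee_nneseries => // n _; first by move=> _; apply: integral_ge0.
  rewrite integral_EFinZ//; last exact: ltW.
  rewrite integral_indic// setIT.
  apply: (@le_trans _ _ ((c n)%:E * (fine (mu (F n)))%:E)%E).
    by rewrite fineK// ge0_fin_numE//; case: (Ffin n).
  rewrite -EFinM lee_fin /c mulrAC ler_piMl ?(ltW (h0 n))//.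
  by rewrite mulrC ler_pdivrMr ?ltr_wpDr// mul1r lerDr.
Qed.

End Weights.

Lemma cvgn_of_geometric (R : realType) (u : R^nat) (C q : R) :
  0 <= q < 1 -> 0 <= C -> (forall n, `|u n.+1 - u n| <= C * q ^+ n) -> cvgn u.
Proof.
move=> /andP[q0 q1] C0 h.
have cs : cvgn (series (telescope u)).
  apply: normed_cvg; apply: (@series_le_cvg R _ (geometric C q)) => //.
  - by move=> n; exact: normr_ge0.
  - by move=> n; rewrite /geometric /= mulr_ge0// exprn_ge0.
  - by apply: is_cvg_geometric_series; rewrite ger0_norm.
rewrite (_ : u = fun n => u 0%N + series (telescope u) n).
  by apply: is_cvgD => //; exact: is_cvg_cst.
by apply/funext => n; rewrite [LHS]eq_sum_telescope.
Qed.

Section Komlos.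
Context {R : realType} {d : measure_display} {X : measurableType d}.
Variable mu : {sigma_finite_measure set X -> \bar R}.
Variables (J : finType) (W : nat -> set (J -> X -> R)).
Hypothesis W_meas : forall n phi, W n phi -> forall j,
  measurable_fun setT (phi j) /\ forall x, 0 <= phi j x.
Hypothesis W_nonempty : forall n, W n !=set0.
Hypothesis W_decr : forall n, W n.+1 `<=` W n.
Hypothesis W_mid : forall n phi psi, W n phi -> W n psi ->
  W n (fun j x => (phi j x + psi j x) / 2).

Let W_le m n : (m <= n)%N -> W n `<=` W m.
Proof.
move=> mn; rewrite -(subnK mn); elim: (n - m)%N => [|i ih] //.
by rewrite addSn; exact: subset_trans (@W_decr _) ih.
Qed.

(** The functional [V phi = \int rho * sum_j exp (- phi_j)] is strictly convex
    along midpoints, so near-minimizers of [V] on [W n] are Cauchy for the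
    square distance of [exp (- phi_j / 2)]. *)
Lemma decreasing_convex_cvg : exists g : nat -> J -> X -> R,
  (forall n, W n (g n)) /\
  {ae mu, forall x, forall j, cvgn (fun n => expR (- g n j x / 2))}.
Proof.
have [rho [mrho rho0 rhoy]] := exists_positive_integrable mu.
have rho0' x : 0 <= rho x := ltW (rho0 x).
pose v (phi : J -> X -> R) x := \sum_j expR (- phi j x) * rho x.
pose V phi := fine (\int[mu]_x (v phi x)%:E)%E.
have mexp (phi : J -> X -> R) : (forall j, measurable_fun setT (phi j)) ->
    forall j (a : R), measurable_fun setT (fun x => expR (- phi j x * a)).
  move=> mphi j a; apply: measurableT_comp => //; apply: measurable_funM => //.
  exact: measurableT_comp.
have mv n phi : W n phi -> measurable_fun setT (v phi).
  move=> Wphi; apply: measurable_sum => j; apply: measurable_funM => //.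
  have := mexp phi (fun j => (W_meas Wphi j).1) j 1.
  by under eq_fun do rewrite mulr1.
have v0 phi x : 0 <= v phi x.
  by apply: sumr_ge0 => j _; rewrite mulr_ge0// expR_ge0.
have Vfin n phi : W n phi -> (\int[mu]_x (v phi x)%:E < +oo)%E.
  move=> Wphi; apply: (@le_lt_trans _ _ (\int[mu]_x (#|J|%:R * rho x)%:E)%E).
    apply: integral_EFin_le => //; first exact: mv Wphi.
    - by apply: measurable_funM => //; exact: measurable_cst.
    - by move=> x; rewrite mulr_ge0.
    apply: nearW => x; rewrite mulr_natl -sumr_const.
    apply: ler_sum => j _; rewrite ler_piMl// -expR0 ler_expR oppr_le0.
    exact: (W_meas Wphi j).2.
  rewrite integral_EFinZ//.
  move: rhoy; rewrite -ge0_fin_numE; last first.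
    by apply: integral_ge0 => x _; rewrite lee_fin.
  by move=> /fineK <-; rewrite -EFinM ltry.
have VE n phi : W n phi -> ((V phi)%:E = \int[mu]_x (v phi x)%:E)%E.
  move=> Wphi; rewrite fineK// ge0_fin_numE; first exact: Vfin Wphi.
  by apply: integral_ge0 => x _; rewrite lee_fin.
have V0 phi : 0 <= V phi.
  by rewrite fine_ge0//; apply: integral_ge0 => x _; rewrite lee_fin.
pose I n := inf (V @` W n).
have hasI n : has_inf (V @` W n).
  split; first by have [phi Wphi] := W_nonempty n; exists (V phi), phi.
  by exists 0 => _ [phi _ <-].
have I_le n phi : W n phi -> I n <= V phi.
  by move=> Wphi; apply: ge_inf; [exact: (hasI n).2|exists phi].
have I_mono m n : (m <= n)%N -> I m <= I n.
  move=> mn; apply: lb_le_inf; first exact: (hasI n).1.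
  by move=> _ [phi Wphi <-]; apply: I_le; exact: W_le Wphi.
have [phi0 Wphi0] := W_nonempty 0%N.
have hasS : has_sup (range I).
  split; first by exists (I 0%N), 0%N.
  pose Vm := #|J|%:R * fine (\int[mu]_x (rho x)%:E)%E.
  exists Vm => _ [n _ <-].
  have [phi Wphi] := W_nonempty n; apply: (le_trans (I_le _ _ Wphi)).
  rewrite -lee_fin (VE _ _ Wphi) /Vm EFinM fineK; last first.
    by rewrite ge0_fin_numE//; apply: integral_ge0 => x _; rewrite lee_fin.
  rewrite -integral_EFinZ//; apply: integral_EFin_le => //; first exact: mv Wphi.
    - by apply: measurable_funM => //; exact: measurable_cst.
    - by move=> x; rewrite mulr_ge0.
  apply: nearW => x; rewrite mulr_natl -sumr_const.
  apply: ler_sum => j _; rewrite ler_piMl// -expR0 ler_expR oppr_le0.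
  exact: (W_meas Wphi j).2.
pose S := sup (range I).
have IS n : I n <= S by apply: sup_upper_bound => //; exists n.
pose eps n : R := 16^-1 ^+ n.
have eps0 n : 0 < eps n by rewrite exprn_gt0// invr_gt0.
have epsS n : eps n.+1 <= eps n by rewrite /eps exprS ler_piMl ?exprn_ge0//; lra.
have /choice[g gP] : forall n, exists g, exists2 N,
    S - eps n <= I N & [/\ (n <= N)%N, W N g & V g <= S + eps n].
  move=> n.
  have [_ [N _ <-] hN] := sup_adherent (eps0 n) hasS.
  have hM : S - eps n <= I (maxn n N).
    by rewrite (le_trans (ltW hN))// I_mono// leq_maxr.
  have [_ [phi Wphi <-] hphi] := inf_adherent (eps0 n) (hasI (maxn n N)).
  exists phi, (maxn n N) => //; split => //; first exact: leq_maxl.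
  by rewrite (le_trans (ltW hphi))// lerD2r; exact: IS.
exists g; split; first by move=> n; have [N _ [nN WN _]] := gP n; exact: W_le WN.
pose z n j x := expR (- g n j x / 2).
pose Q n x := \sum_j (z n.+1 j x - z n j x) ^+ 2 * rho x.
have Wg n : W n (g n) by have [N _ [nN WN _]] := gP n; exact: W_le WN.
have mz n j : measurable_fun setT (z n j).
  exact: (mexp (g n) (fun j => (W_meas (Wg n) j).1) j 2^-1).
have mQ n : measurable_fun setT (Q n).
  apply: measurable_sum => j; apply: measurable_funM => //.
  by apply: measurable_funX; exact: measurable_funB.
have Q0 n x : 0 <= Q n x.
  by apply: sumr_ge0 => j _; rewrite mulr_ge0// sqr_ge0.
have QI n : (\int[mu]_x (Q n x)%:E <= (4 * eps n)%:E)%E.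
  have [N1 h1 [_ W1 V1]] := gP n; have [N2 h2 [_ W2 V2]] := gP n.+1.
  pose m := minn N1 N2.
  have hm : S - eps n <= I m.
    rewrite /m; case: leqP => _ //; rewrite (le_trans _ h2)//.
    by rewrite lerD2l lerN2.
  have {}W1 : W m (g n) by apply: W_le W1; exact: geq_minl.
  have {}W2 : W m (g n.+1) by apply: W_le W2; exact: geq_minr.
  have Wm := W_mid W2 W1; set mid := (fun j x => _) in Wm.
  have e : (\int[mu]_x (Q n x)%:E + \int[mu]_x (2 * v mid x)%:E =
      \int[mu]_x (v (g n.+1) x)%:E + \int[mu]_x (v (g n) x)%:E)%E.
    rewrite -!integral_EFinD//; first last.
    - by move=> x; rewrite mulr_ge0.
    - by apply: measurable_funM; [exact: measurable_cst|exact: mv Wm].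
    - exact: mv W1.
    - exact: mv W2.
    apply: eq_integral => x _; congr EFin.
    rewrite /Q /v mulr_sumr -!big_split/=; apply: eq_bigr => j _.
    rewrite /mid /z -[expR (- g n.+1 j x)](_ : expR (- g n.+1 j x / 2) ^+ 2 = _); last first.
      by rewrite expr2 -expRD; congr expR; field.
    rewrite -[expR (- g n j x)](_ : expR (- g n j x / 2) ^+ 2 = _); last first.
      by rewrite expr2 -expRD; congr expR; field.
    rewrite (_ : - ((g n.+1 j x + g n j x) / 2)
      = - g n.+1 j x / 2 + - g n j x / 2); last by field.
    by rewrite expRD; ring.
  move: e; rewrite integral_EFinZ//; last exact: mv Wm.
  rewrite -(VE _ _ Wm) -(VE _ _ W1) -(VE _ _ W2) -EFinM -EFinD.
  have Im := I_le _ _ Wm.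
  have : (0 <= \int[mu]_x (Q n x)%:E)%E.
    by apply: integral_ge0 => x _; rewrite lee_fin.
  have eS := epsS n; move: (\int[mu]_x (Q n x)%:E)%E => [q| |] // _.
  rewrite -EFinD => -[] e3; rewrite lee_fin.
  move: Im V1 V2 hm eS e3.
  move: (V mid) (V (g n)) (V (g n.+1)) (I m) (eps n) (eps n.+1).
  by move=> *; lra.
pose T x := (\sum_(n <oo) (4 ^+ n * Q n x)%:E)%E.
have T0 x n : (0 <= (4 ^+ n * Q n x)%:E)%E by rewrite lee_fin mulr_ge0// exprn_ge0.
have mT n : measurable_fun setT (fun x => (4 ^+ n * Q n x)%:E).
  apply/measurable_EFinP; apply: measurable_funM => //; exact: measurable_cst.
have Tfin : {ae mu, forall x, (T x < +oo)%E}.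
  apply: ae_lty.
  - by apply: ge0_emeasurable_sum.
  - by move=> x; apply: nneseries_ge0.
  rewrite /T integral_nneseries//.
  apply: (@le_lt_trans _ _ 8%:E); last exact: ltry.
  apply: le_trans (@epsilon_trick0 R 8 xpredT _); last by [].
  apply: lee_nneseries => [n _ _|n _]; first by apply: integral_ge0.
  rewrite integral_EFinZ ?exprn_ge0//.
  apply: (@le_trans _ _ ((4 ^+ n)%:E * (4 * eps n)%:E)%E).
    by rewrite lee_wpmul2l ?lee_fin ?exprn_ge0.
  rewrite -EFinM lee_fin /eps mulrCA -exprMn natrX exprS invfM.
  rewrite mulrA -exprVn (_ : 8 / 2 = 4); last by field.
  by rewrite ler_pM2l// lerXn2r ?nnegrE//; lra.
apply: filterS Tfin => x Tx j.
have [C C0 hC] : exists2 C, 0 <= C & forall n, 4 ^+ n * Q n x <= C.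
  exists (fine (T x)) => [|n].
    by rewrite fine_ge0//; exact: nneseries_ge0.
  rewrite -lee_fin fineK; last first.
    by rewrite ge0_fin_numE//; exact: nneseries_ge0.
  apply: le_trans (nneseries_lim_ge n.+1 _); last by [].
  by rewrite big_nat_recr//= leeDr// sume_ge0.
pose C' := Num.sqrt (C / rho x).
apply: (@cvgn_of_geometric _ _ C' 2^-1).
- by apply/andP; split; lra.
- exact: sqrtr_ge0.
move=> n; rewrite -(@ler_pXn2r _ 2)// ?nnegrE ?mulr_ge0 ?sqrtr_ge0 ?exprn_ge0//.
rewrite real_normK ?num_real// exprMn sqr_sqrtr ?divr_ge0//.
have h : (z n.+1 j x - z n j x) ^+ 2 * rho x <= Q n x.
  rewrite /Q (bigD1 j)//= lerDl sumr_ge0// => i _.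
  by rewrite mulr_ge0// sqr_ge0.
rewrite -(ler_pM2r (rho0 x)) (le_trans h)// mulrAC divfK ?gt_eqF//.
rewrite -exprM mulnC exprM -(ler_pM2l (_ : 0 < 4 ^+ n)) ?exprn_gt0//.
rewrite (le_trans (hC n))// mulrCA -exprMn.
by rewrite (_ : 4 * 2^-1 ^+ 2 = 1) ?expr1n ?mulr1//; field.
Qed.

End Komlos.
(** * Factorization through convex sets of functions *)

Section PerturbationInequalities.
Context {R : realType}.
Implicit Types a h v t th : R.

Lemma powR_ge_1subV (x th : R) : 0 < x -> 0 <= th ->
  1 + th * (1 - x^-1) <= x `^ th.
Proof.
move=> x0 th0; rewrite /powR gt_eqF//.
apply: le_trans (expR_ge1Dx _); rewrite lerD2l ler_wpM2l//.
have xV : 0 < x^-1 by rewrite invr_gt0.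
have := @le_ln1Dx R (x^-1 - 1); rewrite subrKC lnV ?posrE// => /(_ _) h.
by have := h (_ : -1 < x^-1 - 1); rewrite ltrBrDl subrr => /(_ xV); lra.
Qed.

(** The first-order condition, in finite form: a step of size [t] from [a]
    towards a tilt of [v] gains [t * v * a `^ (th - 1)] up to constants. Moving
    the base point from the perturbed value back to [a] costs the factor
    [h / (h + dl * v)], because [a >= dl * h] and [t = dl ^+ 2]. *)
Lemma perturbation_gain a h v (dl th t : R) : t = dl ^+ 2 ->
  0 < h -> dl * h <= a -> 0 <= v -> 0 < dl <= 2^-1 -> 0 < th <= 1 ->
  th * t / 2 * (v * (a `^ th / a) * (h / (h + dl * v)))
  <= ((1 - t) * a + t * (dl * h + (1 - dl) * v)) `^ th - a `^ th
     + 2 * th * t * a `^ th.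
Proof.
move=> tE h0 ha v0 /andP[dl0 dl2] /andP[th0 th1].
have a0 : 0 < a by rewrite (lt_le_trans _ ha)// mulr_gt0.
have t0 : 0 < t by rewrite tE exprn_gt0.
have t4 : t <= 2^-1 / 2.
  rewrite tE expr2; apply: ler_pM => //; lra.
have [v' v'E] : exists v', v' = dl * h + (1 - dl) * v by eexists.
have [a' a'E] : exists a', a' = (1 - t) * a + t * v' by eexists.
rewrite -v'E -a'E.
have v'0 : 0 < v'.
  by rewrite v'E ltr_pwDl ?mulr_gt0// mulr_ge0//; lra.
have v'v : v <= 2 * v'.
  rewrite v'E; have : 0 <= dl * h by rewrite mulr_ge0// ltW.
  have : 0 <= (1 - 2 * dl) * v by rewrite mulr_ge0//; lra.
  lra.
have a'0 : 0 < a' by rewrite a'E addr_gt0// mulr_gt0//; lra.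
have a'a : a <= 2 * a'.
  have : 0 <= (1 - 2 * t) * a by rewrite mulr_ge0 ?(ltW a0)//; lra.
  have : 0 < t * v' by rewrite mulr_gt0.
  rewrite a'E; lra.
have xE : a' `^ th = a `^ th * (a' / a) `^ th.
  rewrite -(powRM th (ltW a0) (divr_ge0 (ltW a'0) (ltW a0))).
  by rewrite mulrCA mulfV ?mulr1// gt_eqF.
have hx := @powR_ge_1subV (a' / a) th (divr_gt0 a'0 a0) (ltW th0).
rewrite xE (_ : a `^ th * (a' / a) `^ th - a `^ th + 2 * th * t * a `^ th
  = a `^ th * ((a' / a) `^ th - 1 + 2 * th * t)); last by ring.
rewrite (_ : th * t / 2 * (v * (a `^ th / a) * (h / (h + dl * v)))
  = a `^ th * (th * (t * (2^-1 * v * h / (a * (h + dl * v)))))); last first.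
  by field; rewrite !gt_eqF// ltr_wpDr// mulr_ge0// ltW.
rewrite ler_pM2l ?powR_gt0//.
apply: (@le_trans _ _ (th * ((1 - a / a') + 2 * t))); last first.
  by rewrite invf_div in hx; rewrite mulrDr; lra.
rewrite ler_pM2l//.
apply: (@le_trans _ _ (t * (v' / a'))); last first.
  rewrite (_ : 1 - a / a' + 2 * t = (a' - a + 2 * t * a') / a'); last first.
    by field; rewrite gt_eqF.
  rewrite mulrA ler_pM2r ?invr_gt0//.
  have : t * a <= t * (2 * a') by rewrite ler_pM2l.
  rewrite {2}a'E; lra.
rewrite ler_pM2l//.
have den : 0 < a * (h + dl * v).
  by rewrite mulr_gt0// ltr_wpDr// mulr_ge0// ltW.
rewrite ler_pdivrMr// [leRHS]mulrAC ler_pdivlMr//.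
have h1 : v * (h * a) <= 2 * v' * (h * a) by rewrite ler_pM2r// mulr_gt0.
have h2 : v * v' * (h * t) <= v * v' * (dl * a).
  rewrite ler_wpM2l ?mulr_ge0 ?(ltW v'0)// tE expr2 mulrCA.
  by rewrite ler_pM2l// mulrC.
have h3 : 0 <= v * h * (t * a) by rewrite !mulr_ge0// ltW.
have h4 : 0 <= v * v' * (dl * a) by rewrite !mulr_ge0// ltW.
rewrite a'E; lra.
Qed.

(** Where some [h] vanishes no gain is claimed, but the step must not lose more
    than first order. *)
Lemma perturbation_loss a (a' t th : R) : 0 <= a -> 0 < t <= 2^-1 ->
  0 < th <= 1 -> (1 - t) * a <= a' ->
  0 <= a' `^ th - a `^ th + 2 * th * t * a `^ th.
Proof.
move=> a0 /andP[t0 t2] /andP[th0 th1] aa'.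
have s0 : 0 < 1 - t by lra.
apply: (@le_trans _ _ (((1 - t) * a) `^ th - a `^ th + 2 * th * t * a `^ th)).
  rewrite powRM ?(ltW s0)//.
  rewrite (_ : _ + _ = a `^ th * ((1 - t) `^ th - 1 + 2 * th * t)); last by ring.
  rewrite mulr_ge0 ?powR_ge0//.
  have := powR_ge_1subV s0 (ltW th0).
  have : (1 - t)^-1 <= 1 + 2 * t.
    rewrite -[leLHS]mul1r ler_pdivrMr//.
    have : 0 <= t * (1 - 2 * t) by rewrite mulr_ge0//; lra.
    lra.
  move=> h; have := ler_wpM2l (ltW th0) h; lra.
rewrite !lerD2r ge0_ler_powR ?nnegrE ?(ltW th0)//.
  by rewrite mulr_ge0// ltW.
by apply: le_trans aa'; rewrite mulr_ge0// ltW.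
Qed.

End PerturbationInequalities.

Lemma cvg_finsum (R : realType) (I : Type) (s : seq I) (f : I -> nat -> R)
    (l : I -> R) : (forall i, f i n @[n --> \oo] --> l i) ->
  \sum_(i <- s) f i n @[n --> \oo] --> \sum_(i <- s) l i.
Proof.
move=> fl; elim: s => [|i s ih].
  by under eq_fun do rewrite big_nil; rewrite big_nil; exact: cvg_cst.
under eq_fun do rewrite big_cons; rewrite big_cons.
exact: cvgD.
Qed.

(** If the geometric means of a convergent sequence of positive vectors stay
    at least one, no coordinate can tend to zero, as the others are bounded. *)
Lemma cvg_geometric_mean_ge1 (R : realType) (J : finType) (th : J -> R)
    (g : nat -> J -> R) (l : J -> R) :
  (forall j, 0 < th j) ->
  (forall j, g n j @[n --> \oo] --> l j) ->
  (\forall n \near \oo, (forall j, 0 < g n j) /\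
     0 <= \sum_j th j * ln (g n j)) ->
  1 <= \prod_j l j `^ th j.
Proof.
move=> th0 gl gP.
have l0 j : 0 < l j.
  pose m n := expR (- (\sum_(i | i != j) th i * g n i) / th j).
  apply: (@lt_le_trans _ _ (expR (- (\sum_(i | i != j) th i * l i) / th j))).
    exact: expR_gt0.
  apply: (@ler_cvg_to _ _ _ _ m (g ^~ j) _ _ _ (gl j)).
    apply: (@continuous_cvg _ _ _ _ _ _ expR); first exact: continuous_expR.
    apply: cvgM; last exact: cvg_cst.
    apply: cvgN.
    under eq_fun do rewrite big_mkcond; rewrite big_mkcond.
    apply: cvg_finsum => i; case: ifP => _; last exact: cvg_cst.
    by apply: cvgM; [exact: cvg_cst|exact: gl].
  apply: filterS gP => n [gp lnp]; rewrite /m.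
  rewrite -[leRHS](lnK (_ : g n j \in Num.pos)) ?posrE// ler_expR.
  rewrite ler_pdivrMr// mulrC -[leRHS]opprK lerN2.
  rewrite (bigD1 j)//= in lnp.
  have : \sum_(i | i != j) th i * ln (g n i) <= \sum_(i | i != j) th i * g n i.
    apply: ler_sum => i _; rewrite ler_pM2l//.
    exact/ltW/ln_sublinear.
  lra.
have sum0 : 0 <= \sum_j th j * ln (l j).
  have c : \sum_j th j * ln (g n j) @[n --> \oo] --> \sum_j th j * ln (l j).
    apply: (@cvg_finsum _ _ _ (fun j n => th j * ln (g n j))) => j.
    apply: (@cvgM _ _ _ _ (fun=> th j) (fun n => ln (g n j))).
      exact: cvg_cst.
    exact: (@continuous_cvg _ _ _ _ _ (g ^~ j) (@ln R) (l j)
      (@continuous_ln R (l j) (l0 j)) (gl j)).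
  by apply: (cvgr_to_ge c); apply: filterS gP => n [].
rewrite (_ : \prod_j _ = expR (\sum_j th j * ln (l j))).
  by rewrite -expR0 ler_expR.
rewrite expR_sum; apply: eq_bigr => j _.
by rewrite /powR (gt_eqF (l0 j)).
Qed.

Lemma limn_einf_ge0 (R : realType) (u : nat -> R) :
  (forall n, 0 <= u n) -> (0 <= limn_einf (fun n => (u n)%:E))%E.
Proof.
move=> u0; rewrite limn_einf_lim; apply: lime_ge; first exact: is_cvg_einfs.
apply: nearW => n; apply: le_ereal_inf_tmp => _ [m _ <-].
by rewrite lee_fin.
Qed.

Section FatouBound.
Context {R : realType} {d : measure_display} {X : measurableType d}.
Variables (mu : {measure set X -> \bar R}) (f : nat -> X -> R) (C : R).
Hypothesis mf : forall n, measurable_fun setT (f n).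
Hypothesis f0 : forall n x, 0 <= f n x.

Lemma measurable_limn_einf :
  measurable_fun setT (fun x => limn_einf (fun n => (f n x)%:E)).
Proof.
rewrite (_ : (fun x => _) = fun x => oppe (limn_esup (fun n => (- f n x)%:E))).
  apply: measurableT_comp => //; apply: measurable_fun_limn_esup => n.
  by apply/measurable_EFinP; exact: measurableT_comp.
apply/funext => x.
by rewrite -[RHS]limn_einfN; congr limn_einf; apply/funext => n /=; rewrite opprK.
Qed.

Lemma fatou_bound : (forall n, (\int[mu]_x (f n x)%:E <= C%:E)%E) ->
  (\int[mu]_x limn_einf (fun n => (f n x)%:E) <= C%:E)%E.
Proof.
move=> fC; apply: le_trans (fatou mu measurableT _ _) _.
- by move=> n; exact/measurable_EFinP.
- by move=> n x _; rewrite lee_fin.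
rewrite limn_einf_lim; apply: lime_le; first exact: is_cvg_einfs.
apply: nearW => n; apply: le_trans (fC n); apply: ereal_inf_lbound.
by exists n => /=.
Qed.

End FatouBound.

Section Factorization.
Context {R : realType} {d : measure_display} {X : measurableType d}.
Variable mu : {sigma_finite_measure set X -> \bar R}.
Variables (J : finType) (th : J -> R) (K : J -> set (X -> R)).
Variables (h : nat -> J -> X -> R) (B : R).
Hypotheses (th0 : forall j, 0 < th j) (th1 : \sum_j th j = 1) (B0 : 0 < B).
Hypothesis K_meas : forall j u, K j u -> measurable_fun setT u.
Hypothesis K_ge0 : forall j u x, K j u -> 0 <= u x.
Hypothesis K_convex : forall j u v t, K j u -> K j v -> 0 <= t <= 1 ->
  K j (fun x => (1 - t) * u x + t * v x).
Hypothesis K_bound : forall u, (forall j, K j (u j)) ->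
  (\int[mu]_x (\prod_j u j x `^ th j)%:E <= B%:E)%E.
Hypothesis K_h : forall n j, K j (h n j).
Hypothesis h_mono : forall n j x, h n j x <= h n.+1 j x.
Hypothesis h_pos : {ae mu, forall x, forall j, exists n, 0 < h n j x}.

Implicit Types (n : nat) (j : J) (phi psi : J -> X -> R) (u v : X -> R) (x : X).

Let th_le1 j : th j <= 1.
Proof. by rewrite -th1 (bigD1 j)//= lerDl sumr_ge0// => i _; exact: ltW. Qed.

Let th01 j : 0 < th j <= 1. Proof. by rewrite th0 th_le1. Qed.

Let dl n : R := (n.+2%:R)^-1.

Let dl0 n : 0 < dl n. Proof. by rewrite invr_gt0. Qed.

Let dl2 n : dl n <= 2^-1.
Proof. by rewrite lef_pV2 ?posrE// ler_nat. Qed.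

Let h0 n j x : 0 <= h n j x. Proof. exact: K_ge0 (K_h n j). Qed.

(* An indicator function, written as a product to be visibly measurable. *)
Let e n x : R := \prod_j (0 < h n j x)%R%:R.

Let eP n x : (e n x = 1 /\ forall j, 0 < h n j x) \/ e n x = 0.
Proof.
have [/forallP hx|hx] := boolP [forall j, 0 < h n j x]; [left|right].
  by split => //; rewrite /e big1// => j _; rewrite hx.
move: hx; rewrite negb_forall => /existsP[j hj].
apply/eqP/prodf_eq0; exists j => //.
by rewrite (negbTE hj).
Qed.

Let e1 n x : (forall j, 0 < h n j x) -> e n x = 1.
Proof. by move=> hx; rewrite /e big1// => j _; rewrite hx. Qed.

Let e0 n x : 0 <= e n x.
Proof. by case: (eP n x) => [[->]|->]. Qed.

Let me n : measurable_fun setT (e n).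
Proof.
apply: measurable_prod => j _.
have -> : (fun x => (0 < h n j x)%R%:R) = \1_(h n j @^-1` `]0, +oo[) :> (X -> R).
  apply/funext => x; rewrite indicE; congr (_%:R); congr nat_of_bool.
  by apply/idP/idP; rewrite inE /= in_itv/= andbT.
apply: measurable_indic; rewrite -[_ @^-1` _]setTI.
exact: K_meas (K_h n j) _ _ _.
Qed.

(** The truncation factor in front of the test function [v]; it increases to
    one with [n]. *)
Definition kern n j (v : X -> R) x := e n x * (h n j x / (h n j x + dl n * v x)).

Let kern0 n j v x : 0 <= v x -> 0 <= kern n j v x.
Proof.
by move=> v0; rewrite mulr_ge0// divr_ge0// addr_ge0// mulr_ge0// ltW.
Qed.

Let mkern n j v : K j v -> measurable_fun setT (kern n j v).
Proof.
move=> Kv; have mh := K_meas (K_h n j); have mv := K_meas Kv.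
apply: measurable_funM => //; apply: measurable_funM => //.
rewrite (_ : (fun x => _) = fun x => (h n j x + dl n * v x) `^ (-1)).
  apply: measurable_powRl; apply: measurable_funD => //.
  by apply: measurable_funM => //; exact: measurable_cst.
apply/funext => x; rewrite powR_inv1// addr_ge0//.
by rewrite mulr_ge0 ?(ltW (dl0 n))// (K_ge0 _ Kv).
Qed.

Let kernS n j v x : 0 <= v x -> kern n j v x <= kern n.+1 j v x.
Proof.
move=> v0; case: (eP n x) => [[_ hx]|en0]; last first.
  by rewrite {1}/kern en0 mul0r kern0.
have hS i : 0 < h n.+1 i x by rewrite (lt_le_trans (hx i)).
rewrite /kern !e1// !mul1r.
have dv m : 0 <= dl m * v x by rewrite mulr_ge0// ltW.
rewrite ler_pdivrMr ?ltr_pwDl// mulrAC ler_pdivlMr ?ltr_pwDl//.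
rewrite !mulrDr [h n j x * _]mulrC lerD2l !mulrA ler_wpM2r//.
apply: ler_pM => //; first exact: ltW.
by rewrite lef_pV2 ?posrE// ler_nat.
Qed.

(** Candidate weights at stage [n]: the logarithm of the geometric mean is
    controlled where [h n] is positive, and the test integrals are truncated.
    These sets decrease in [n]. *)
Definition stage n : set (J -> X -> R) := [set phi : J -> X -> R | [/\
  forall j, measurable_fun setT (phi j) /\ forall x, 0 <= phi j x,
  forall x, (forall j, 0 < h n j x) ->
     (forall j, 0 < phi j x) /\ 0 <= \sum_j th j * ln (phi j x) &
  forall j v, K j v ->
    (\int[mu]_x (v x * phi j x * kern n j v x)%:E <= (6 * B)%:E)%E]].

Let mterm n (w : X -> R) j v : measurable_fun setT w -> K j v ->
  measurable_fun setT (fun x => v x * w x * kern n j v x).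
Proof.
move=> mw Kv; apply: measurable_funM; last exact: mkern.
by apply: measurable_funM => //; exact: K_meas Kv.
Qed.

Lemma stage_decr n : stage n.+1 `<=` stage n.
Proof.
move=> phi [pos logs tests]; split => //.
- by move=> x hx; apply: logs => j; rewrite (lt_le_trans (hx j)).
move=> j v Kv; apply: le_trans (tests j v Kv).
have [mphi phi0] := pos j; have v0 x := K_ge0 x Kv.
apply: integral_EFin_le; try exact: mterm.
- by move=> x; exact: (mulr_ge0 (mulr_ge0 (v0 x) (phi0 x)) (kern0 _ _ (v0 x))).
- by move=> x; exact: (mulr_ge0 (mulr_ge0 (v0 x) (phi0 x)) (kern0 _ _ (v0 x))).
- apply: nearW => x.
  exact: (ler_wpM2l (mulr_ge0 (v0 x) (phi0 x)) (kernS _ _ (v0 x))).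
Qed.

(** Concavity of [ln] is what makes the stages below midpoint convex. *)
Lemma ln_mid_ge (a b : R) : 0 < a -> 0 < b ->
  (ln a + ln b) / 2 <= ln ((a + b) / 2).
Proof.
move=> a0 b0; have m0 : 0 < (a + b) / 2 by rewrite divr_gt0// addr_gt0.
have : ln (a * b) <= ln (((a + b) / 2) ^+ 2).
  have ab0 : 0 < a * b by exact: mulr_gt0.
  have mm0 : 0 < ((a + b) / 2) ^+ 2 by exact: exprn_gt0.
  rewrite ler_ln ?posrE//.
  by have := sqr_ge0 (a - b); rewrite sqrrB; lra.
rewrite lnM ?posrE// lnXn// mulr2n; lra.
Qed.

Lemma stage_mid n phi psi : stage n phi -> stage n psi ->
  stage n (fun j x => (phi j x + psi j x) / 2).
Proof.
move=> [pos logs tests] [pos' logs' tests']; split.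
- move=> j; have [m1 p1] := pos j; have [m2 p2] := pos' j; split.
    by apply: measurable_funM; [exact: measurable_funD|exact: measurable_cst].
  by move=> x; rewrite divr_ge0// addr_ge0.
- move=> x hx; have [p1 l1] := logs x hx; have [p2 l2] := logs' x hx; split.
    by move=> j; rewrite divr_gt0// addr_gt0.
  apply: (@le_trans _ _ ((\sum_j th j * ln (phi j x)
      + \sum_j th j * ln (psi j x)) / 2)); first by rewrite divr_ge0// addr_ge0.
  rewrite -big_split/= mulr_suml; apply: ler_sum => j _.
  by rewrite -mulrDr -mulrA ler_pM2l// ln_mid_ge.
move=> j v Kv; have [m1 p1] := pos j; have [m2 p2] := pos' j.
have v0 x := K_ge0 x Kv; have k0 x := kern0 n j (v0 x).
have t1 x := mulr_ge0 (mulr_ge0 (v0 x) (p1 x)) (k0 x).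
have t2 x := mulr_ge0 (mulr_ge0 (v0 x) (p2 x)) (k0 x).
have -> : (\int[mu]_x (v x * ((phi j x + psi j x) / 2) * kern n j v x)%:E
  = \int[mu]_x (2^-1 * (v x * phi j x * kern n j v x
       + v x * psi j x * kern n j v x))%:E)%E.
  by apply: eq_integral => x _; congr EFin; ring.
rewrite integral_EFinZ//; last 2 first.
- by apply: measurable_funD; exact: mterm.
- by move=> x; exact: addr_ge0.
rewrite integral_EFinD//; [|exact: mterm..].
apply: (@le_trans _ _ ((2^-1)%:E * ((6 * B)%:E + (6 * B)%:E))%E).
  by rewrite lee_wpmul2l ?lee_fin//; apply: leeD; [exact: tests|exact: tests'].
by rewrite -EFinD -EFinM lee_fin; lra.
Qed.

(** A near-maximizer [u] of the integral of the geometric mean over the convex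
    set of all [dl n * h n + (1 - dl n) * v]: its first-order condition says
    that the weights [prod_i u_i `^ th_i / u_j] pass the truncated tests. *)
Lemma stage_nonempty n : stage n !=set0.
Proof.
have [del delE] : exists del, del = dl n by eexists.
have [t tE] : exists t, t = del ^+ 2 by eexists.
have del01 : 0 < del <= 2^-1 by rewrite delE dl0 dl2.
have /andP[del0 del2] := del01.
have t0 : 0 < t by rewrite tE exprn_gt0.
have t2 : t <= 2^-1.
  have : del * del <= del * 1 by rewrite ler_wpM2l ?(ltW del0)//; lra.
  by rewrite tE expr2; lra.
pose tilt j v x := del * h n j x + (1 - del) * v x.
have tiltK j v : K j v -> K j (tilt j v).
  move=> Kv; rewrite (_ : tilt j v
      = fun x => (1 - (1 - del)) * h n j x + (1 - del) * v x).
    by apply: K_convex => //; apply/andP; split; lra.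
  by apply/funext => x; rewrite /tilt; ring.
pose P (u : J -> X -> R) := forall j, exists2 v, K j v & u j = tilt j v.
have PK (u : J -> X -> R) : P u -> forall j, K j (u j).
  by move=> Pu j; have [v Kv ->] := Pu j; exact: tiltK.
pose gm (u : J -> X -> R) x := \prod_j u j x `^ th j.
have gm0 (u : J -> X -> R) x : 0 <= gm u x by apply: prodr_ge0 => j _; exact: powR_ge0.
have mgm (u : J -> X -> R) : P u -> measurable_fun setT (gm u).
  move=> Pu; apply: measurable_prod => j _; apply: measurable_powRl.
  exact: K_meas (PK u Pu j).
pose V (u : J -> X -> R) := fine (\int[mu]_x (gm u x)%:E)%E.
have VE (u : J -> X -> R) : P u -> (\int[mu]_x (gm u x)%:E = (V u)%:E)%E.
  move=> Pu; rewrite fineK// ge0_fin_numE.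
    by apply: le_lt_trans (K_bound (PK u Pu)) _; exact: ltry.
  by apply: integral_ge0 => x _; rewrite lee_fin.
have VB (u : J -> X -> R) : P u -> V u <= B.
  by move=> Pu; rewrite -lee_fin -VE//; exact: K_bound (PK u Pu).
pose eps := t * B * \prod_j th j.
have eps0 : 0 < eps.
  by rewrite mulr_gt0 ?mulr_gt0//; apply: prodr_gt0 => j _.
have eps_le j : eps <= t * B * th j.
  rewrite ler_pM2l ?mulr_gt0// (bigD1 j)//= ler_piMr ?(ltW (th0 j))//.
  by apply: Num.Theory.prodr_ile1 => i _; rewrite th_le1 ltW.
have hasS : has_sup (V @` P).
  split; first by exists (V (fun j => tilt j (h n j))), (fun j => tilt j (h n j)) => // j; exists (h n j).
  by exists B => _ [u Pu <-]; exact: VB.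
have [_ [u Pu <-] hu] := sup_adherent eps0 hasS.
have max (u' : J -> X -> R) : P u' -> V u' <= V u + eps.
  move=> Pu'; rewrite -lerBlDr (le_trans _ (ltW hu))// lerB//.
  by apply: sup_upper_bound => //; exists u'.
have Ku := PK u Pu; have mu_ j := K_meas (Ku j); have u0 j x := K_ge0 x (Ku j).
have uh j x : del * h n j x <= u j x.
  have [v Kv ->] := Pu j; rewrite /tilt lerDl mulr_ge0 ?(K_ge0 _ Kv)//; lra.
have upos x : (forall j, 0 < h n j x) -> forall j, 0 < u j x.
  by move=> hx j; rewrite (lt_le_trans _ (uh j x))// mulr_gt0.
pose L x := \sum_j th j * ln (u j x).
exists (fun j x => e n x * expR (L x - ln (u j x))); split.
- move=> j; split; last by move=> x; rewrite mulr_ge0// expR_ge0.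
  apply: measurable_funM => //; apply: measurableT_comp => //.
  apply: measurable_funB; last by apply: measurableT_comp => //; exact: mu_.
  apply: measurable_sum => i; apply: measurable_funM => //.
  by apply: measurableT_comp => //; exact: mu_.
- move=> x hx; rewrite e1//; split => [j|]; first by rewrite mul1r expR_gt0.
  under eq_bigr do rewrite mul1r expRK mulrBr.
  by rewrite sumrB -mulr_suml th1 mul1r -/(L x) subrr.
move=> j v Kv; have v0 x := K_ge0 x Kv.
pose u' i := if i == j then fun x => (1 - t) * u j x + t * tilt j v x else u i.
have Pu' : P u'.
  move=> i; rewrite /u'; case: eqP => [->|_]; last exact: (Pu i).
  have [w Kw uw] := Pu j; exists (fun x => (1 - t) * w x + t * v x).
    by apply: K_convex => //; apply/andP; split; lra.
  by rewrite uw; apply/funext => x; rewrite /tilt; ring.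
have Ku' := PK u' Pu'.
pose G x := \prod_(i | i != j) u i x `^ th i.
have G0 x : 0 <= G x by apply: prodr_ge0 => i _; exact: powR_ge0.
have gmE x : gm u x = u j x `^ th j * G x by rewrite /gm (bigD1 j).
have gmE' x : gm u' x = ((1 - t) * u j x + t * tilt j v x) `^ th j * G x.
  rewrite /gm (bigD1 j)//= /u' eqxx; congr (_ * _).
  by apply: eq_bigr => i /negbTE ->.
pose phi x := e n x * expR (L x - ln (u j x)).
have phi0 x : 0 <= phi x by rewrite mulr_ge0// expR_ge0.
have phiE x : (forall i, 0 < h n i x) -> phi x = G x * (u j x `^ th j / u j x).
  move=> hx; have ux := upos x hx; rewrite /phi e1// mul1r expRB lnK ?posrE//.
  have -> : expR (L x) = gm u x.
    rewrite /L expR_sum; apply: eq_bigr => i _.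
    by rewrite /powR (gt_eqF (ux i)).
  by rewrite gmE; ring.
pose c := th j * t / 2.
have c0 : 0 < c by rewrite divr_gt0// mulr_gt0.
have key x : c * (v x * phi x * kern n j v x) + gm u x
    <= gm u' x + 2 * th j * t * gm u x.
  rewrite gmE' gmE -subr_ge0.
  rewrite (_ : _ - _ = G x * (((1 - t) * u j x + t * tilt j v x) `^ th j
     - u j x `^ th j + 2 * th j * t * u j x `^ th j)
     - c * (v x * phi x * kern n j v x)); last by ring.
  rewrite subr_ge0; case: (eP n x) => [[ex hx]|ex]; last first.
    rewrite /kern ex mul0r !mulr0 mulr_ge0//; apply: perturbation_loss => //.
      by rewrite t0 t2.
    by rewrite lerDl mulr_ge0 ?(ltW t0)//; exact: K_ge0 (tiltK _ _ Kv).
  rewrite phiE// /kern ex mul1r -delE.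
  rewrite (_ : c * _ = G x * (c * (v x * (u j x `^ th j / u j x)
    * (h n j x / (h n j x + del * v x))))); last by ring.
  by apply: ler_wpM2l => //; exact: perturbation_gain.
have mphi : measurable_fun setT phi.
  apply: measurable_funM => //; apply: measurableT_comp => //.
  apply: measurable_funB; last by apply: measurableT_comp => //; exact: mu_.
  apply: measurable_sum => i; apply: measurable_funM => //.
  by apply: measurableT_comp => //; exact: mu_.
have q0 x : 0 <= v x * phi x * kern n j v x.
  exact: (mulr_ge0 (mulr_ge0 (v0 x) (phi0 x)) (kern0 n j (v0 x))).
have mq := mterm n mphi Kv.
have mc (w : X -> R) (a : R) :
    measurable_fun setT w -> measurable_fun setT (fun x => a * w x).
  by move=> mw; apply: measurable_funM => //; exact: measurable_cst.
have a0 : 0 <= 2 * th j * t by rewrite !mulr_ge0// ltW.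
have : (\int[mu]_x (c * (v x * phi x * kern n j v x) + gm u x)%:E
     <= \int[mu]_x (gm u' x + 2 * th j * t * gm u x)%:E)%E.
  apply: integral_EFin_le.
  - by apply: measurable_funD; [exact: mc|exact: mgm].
  - by apply: measurable_funD; [exact: mgm|apply: mc; exact: mgm].
  - by move=> x; rewrite addr_ge0// mulr_ge0// ltW.
  - by move=> x; rewrite addr_ge0// mulr_ge0.
  - exact: nearW.
rewrite integral_EFinD//; [|exact: mc|exact: mgm|by move=> x; rewrite mulr_ge0// ltW].
rewrite integral_EFinD//; [|exact: mgm|by apply: mc; exact: mgm|by move=> x; rewrite mulr_ge0].
rewrite !integral_EFinZ//; [|exact: mgm|exact: ltW].
rewrite !VE// -EFinM -EFinD.
have : (0 <= \int[mu]_x (v x * phi x * kern n j v x)%:E)%E.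
  by apply: integral_ge0 => x _; rewrite lee_fin.
rewrite -/(phi _).
move: (\int[mu]_x (v x * phi x * kern n j v x)%:E)%E => [q| |] //= _; last first.
  by rewrite mulry gtr0_sg// mul1e.
rewrite -EFinM -EFinD !lee_fin => hq.
have := max _ Pu'; have := eps_le j; have := VB u Pu => h1 h2 h3.
have h4 : 2 * th j * t * V u <= 2 * th j * t * B by rewrite ler_wpM2l.
have h5 : c * q <= c * (6 * B).
  have cE : c * (6 * B) = 3 * (t * B * th j) by rewrite /c; field.
  have aE : 2 * th j * t * B = 2 * (t * B * th j) by ring.
  rewrite aE in h4; rewrite cE.
  move: hq h1 h2 h3 h4; move: (c * q) (2 * th j * t * V u) (t * B * th j).
  by move: (V u) (V u') (eps) => *; lra.
by rewrite -(ler_pM2l c0).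
Qed.

Let h_le m n j x : (m <= n)%N -> h m j x <= h n j x.
Proof.
move=> mn; rewrite -(subnK mn); elim: (n - m)%N => [|i ih] //.
by rewrite addSn (le_trans ih).
Qed.

Let dl_cvg : dl n @[n --> \oo] --> 0.
Proof.
rewrite (_ : dl = [sequence harmonic n.+1]_n)//.
by rewrite cvg_shiftS; exact: cvg_harmonic.
Qed.

Let kern_cvg j v x : 0 <= v x -> (exists N, forall i, 0 < h N i x) ->
  kern n j v x @[n --> \oo] --> (1 : R).
Proof.
move=> v0 [N hN].
have hn n i : (N <= n)%N -> 0 < h n i x.
  by move=> Nn; rewrite (lt_le_trans (hN i))// h_le.
apply: (@squeeze_cvgr _ _ _ _ (fun n => 1 - dl n * (v x / h N j x)) (fun=> 1)).
- near=> n.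
  have Nn : (N <= n)%N by near: n; exact: nbhs_infty_ge.
  rewrite /kern e1; last by move=> i; exact: hn.
  have hj := hn n j Nn; have hNj := hN j.
  have dv : 0 <= dl n * v x by rewrite mulr_ge0// ltW.
  rewrite mul1r; apply/andP; split; last first.
    by rewrite ler_pdivrMr ?ltr_wpDr// mul1r lerDl.
  rewrite ler_pdivlMr ?ltr_wpDr//.
  set c := v x / h N j x; have c0 : 0 <= c by rewrite divr_ge0// ltW.
  have hc : v x <= c * h n j x.
    rewrite /c mulrAC ler_pdivlMr// ler_wpM2l// h_le//.
  have h1 : dl n * v x <= dl n * (c * h n j x) by rewrite ler_wpM2l// ltW.
  have h2 := mulr_ge0 (mulr_ge0 (ltW (dl0 n)) c0) dv.
  rewrite -subr_ge0 (_ : _ - _ = (dl n * (c * h n j x) - dl n * v x)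
    + dl n * c * (dl n * v x)); last by ring.
  by rewrite addr_ge0// subr_ge0.
- rewrite -[X in _ --> X](_ : 1 - 0 * (v x / h N j x) = 1); last by ring.
  apply: cvgB; first exact: cvg_cst.
  by apply: cvgM; [exact: dl_cvg|exact: cvg_cst].
- exact: cvg_cst.
Unshelve. all: by end_near. Qed.

(** A sequence of candidate weights whose exponentials converge has a finite
    limit wherever one truncated test stays bounded along it. *)
Let weight_cvg (g : nat -> R) j v x : 0 < v x ->
  (exists N, forall i, 0 < h N i x) -> cvgn (fun n => expR (- g n / 2)) ->
  (limn_einf (fun n => (v x * g n * kern n j v x)%:E) < +oo)%E ->
  exists l : R, g n @[n --> \oo] --> l.
Proof.
move=> v0 hN /cvg_ex[Z zZ] fin.
have gE n : g n = -2 * ln (expR (- g n / 2)) by rewrite expRK; field.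
have Z0 : 0 <= Z by apply: (cvgr_to_ge zZ); apply: nearW => n; exact: expR_ge0.
have kc := kern_cvg j (ltW v0) hN.
have [ZE|Zn0] := eqVneq Z 0.
  exfalso; move: fin.
  suff /cvgeryP/cvg_limn_einf_sup[-> _] :
    (fun n => v x * g n * kern n j v x) @ \oo --> +oo by [].
  apply/cvgryPge => A; pose A' := 2 * Num.max A 1 / v x.
  have A'0 : 0 < A' by rewrite divr_gt0// mulr_gt0// lt_max ltr01 orbT.
  have z1 : \forall n \near \oo, expR (- g n / 2) < expR (- A' / 2).
    by apply: (cvgr_lt _ zZ); rewrite ZE expR_gt0.
  have k1 : \forall n \near \oo, 2^-1 <= kern n j v x.
    by apply: (cvgr_ge _ kc); lra.
  near=> n.
  have gA : A' <= g n.
    have : expR (- g n / 2) < expR (- A' / 2) by near: n.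
    by rewrite ltr_expR; lra.
  have kn : 2^-1 <= kern n j v x by near: n.
  apply: (@le_trans _ _ (v x * A' * 2^-1)).
    have -> : v x * A' * 2^-1 = Num.max A 1 by rewrite /A'; field; rewrite gt_eqF.
    by rewrite le_max lexx.
  apply: ler_pM => //; first by rewrite mulr_ge0// ltW.
  by rewrite ler_pM2l.
have Zp : 0 < Z by rewrite lt_neqAle eq_sym Zn0.
exists (-2 * ln Z); rewrite (_ : g = fun n => -2 * ln (expR (- g n / 2))).
  apply: (@cvgM _ _ _ _ (fun=> -2) (fun n => ln (expR (- g n / 2)))).
    exact: cvg_cst.
  exact: (@continuous_cvg _ _ _ _ _ (fun n => expR (- g n / 2)) (@ln R) Z
    (@continuous_ln R Z Zp) zZ).
exact/funext.
Unshelve. all: by end_near. Qed.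

Theorem convex_factorization : exists phi : J -> X -> R,
  [/\ forall j, measurable_fun setT (phi j), forall j x, 0 <= phi j x,
      {ae mu, forall x, 1 <= \prod_j phi j x `^ th j}
    & forall j u, K j u -> (\int[mu]_x (u x * phi j x)%:E <= (6 * B)%:E)%E].
Proof.
have [g [Wg gcvg]] := @decreasing_convex_cvg _ _ _ mu _ stage
  (fun n phi Wphi => let: And3 pos _ _ := Wphi in pos)
  stage_nonempty stage_decr stage_mid.
have mg n j : measurable_fun setT (g n j) by have [pos _ _] := Wg n; case: (pos j).
have g0 n j x : 0 <= g n j x by have [pos _ _] := Wg n; case: (pos j).
have f0 n j v x : K j v -> 0 <= v x * g n j x * kern n j v x.
  move=> Kv; have v0 := K_ge0 x Kv.
  exact: (mulr_ge0 (mulr_ge0 v0 (g0 n j x)) (kern0 n j v0)).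
have fatou_test j v : K j v ->
    (\int[mu]_x limn_einf (fun n => (v x * g n j x * kern n j v x)%:E)
     <= (6 * B)%:E)%E.
  move=> Kv; apply: fatou_bound.
  - by move=> n; exact: mterm.
  - by move=> n x; exact: f0.
  - by move=> n; have [_ _ tests] := Wg n; exact: tests.
have hN : {ae mu, forall x, exists N, forall j, 0 < h N j x}.
  apply: filterS h_pos => x /fin_all_exists[N hN].
  exists (\max_j N j)%N => j; apply: (lt_le_trans (hN j)).
  by apply: h_le; exact: leq_bigmax.
have fin : {ae mu, forall x, forall j m, (limn_einf (fun n =>
    (h m j x * g n j x * kern n j (h m j) x)%:E) < +oo)%E}.
  apply: filter_forall => j; apply: ae_foralln => m.
  have Kv := K_h m j; apply: ae_lty.
  - by apply: measurable_limn_einf => n; exact: mterm.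
  - by move=> x; apply: limn_einf_ge0 => n; exact: f0.
  - by apply: le_lt_trans (fatou_test j _ Kv) _; exact: ltry.
pose phi j x := fine (limn_esup (fun n => (g n j x)%:E)).
have phi_cvg : {ae mu, forall x j, g n j x @[n --> \oo] --> phi j x}.
  apply: filterS3 hN fin gcvg => x hNx finx gx j.
  have [N hNx'] := hNx.
  have [l gl] := weight_cvg (g := fun n => g n j x) (hNx' j) hNx (gx j) (finx j N).
  rewrite /phi.
  have /cvg_limn_einf_sup[_ ->] : (g n j x)%:E @[n --> \oo] --> l%:E.
    by apply: cvg_EFin; [exact: nearW|exact: gl].
  by [].
exists phi; split.
- move=> j; apply: measurableT_comp; first exact: fine_measurable.
  by apply: measurable_fun_limn_esup => n; exact/measurable_EFinP.
- move=> j x; rewrite /phi fine_ge0//.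
  apply: le_trans (limn_einf_sup _).
  by apply: limn_einf_ge0 => n; exact: g0.
- apply: filterS2 hN phi_cvg => x [N hNx] gx.
  apply: (@cvg_geometric_mean_ge1 _ _ _ (fun n j => g n j x)) => //.
  near=> n; have [_ logs _] := Wg n; apply: logs => j.
  apply: (lt_le_trans (hNx j)); apply: h_le; near: n; exact: nbhs_infty_ge.
move=> j v Kv; have v0 x := K_ge0 x Kv.
apply: le_trans (fatou_test j v Kv).
rewrite le_eqVlt; apply/orP; left; apply/eqP.
apply: ge0_ae_eq_integral => //.
- apply/measurable_EFinP; apply: measurable_funM; first exact: K_meas Kv.
  apply: measurableT_comp; first exact: fine_measurable.
  by apply: measurable_fun_limn_esup => n; exact/measurable_EFinP.
- by apply: measurable_limn_einf => n; exact: mterm.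
- move=> x _; rewrite lee_fin mulr_ge0// /phi fine_ge0//.
  apply: le_trans (limn_einf_sup _).
  by apply: limn_einf_ge0 => n; exact: g0.
- by move=> x _; apply: limn_einf_ge0 => n; exact: f0.
apply: filterS2 hN phi_cvg => x hNx gx _.
have /cvg_limn_einf_sup[-> _] : (v x * g n j x * kern n j v x)%:E @[n --> \oo]
    --> (v x * phi j x)%:E.
  rewrite -[v x * phi j x]mulr1; apply: cvg_EFin; first exact: nearW.
  by apply: cvgM; [apply: cvgM; [exact: cvg_cst|exact: gx]|exact: kern_cvg].
by [].
Unshelve. all: by end_near. Qed.

End Factorization.
(** * From single functions to convex sets, one factor at a time *)

Section ReplaceFactors.
Context {R : realType} {d : measure_display} {X : measurableType d}.
Variable mu : {measure set X -> \bar R}.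
Variables (J : finType) (G G' : J -> set ((X -> R) * R)) (C : R).

Definition factor_class (H : J -> set ((X -> R) * R)) := forall j q, H j q ->
  [/\ measurable_fun setT q.1, forall x, 0 <= q.1 x & 0 <= q.2].

Hypotheses (hG : factor_class G) (hG' : factor_class G') (C0 : 0 <= C).

Hypothesis step : forall j (omega : X -> R) (M : R),
  measurable_fun setT omega -> (forall x, 0 <= omega x) -> 0 <= M ->
  (forall q, G j q -> (\int[mu]_x (q.1 x * omega x)%:E <= (M * q.2)%:E)%E) ->
  forall q, G' j q -> (\int[mu]_x (q.1 x * omega x)%:E <= (M * q.2)%:E)%E.

(** A factor is a function together with the number that bounds it. If an
    inequality linear in one factor passes from [G j] to [G' j] against every
    weight, the product inequality does, since the remaining factors serve as a
    weight. *)
Lemma replace_factors :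
  (forall q, (forall j, G j (q j)) ->
    (\int[mu]_x (\prod_j (q j).1 x)%:E <= (C * \prod_j (q j).2)%:E)%E) ->
  forall q, (forall j, G' j (q j)) ->
    (\int[mu]_x (\prod_j (q j).1 x)%:E <= (C * \prod_j (q j).2)%:E)%E.
Proof.
move=> base.
suff H (s : seq J) : uniq s -> forall q,
    (forall j, if j \in s then G' j (q j) else G j (q j)) ->
    (\int[mu]_x (\prod_j (q j).1 x)%:E <= (C * \prod_j (q j).2)%:E)%E.
  move=> q Gq; apply: (H (enum J) (enum_uniq J)) => j.
  by rewrite mem_enum.
elim: s => [|j s ih] /=; first by move=> _ q Gq; exact: base.
move=> /andP[js us] q Gq.
have hq i : [/\ measurable_fun setT (q i).1, forall x, 0 <= (q i).1 x & 0 <= (q i).2].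
  by have := Gq i; case: ifP => _; [exact: hG'|exact: hG].
pose omega x := \prod_(i | i != j) (q i).1 x.
pose M := C * \prod_(i | i != j) (q i).2.
have split1 (p : (X -> R) * R) x :
    \prod_i ((if i == j then p else q i).1 x) = p.1 x * omega x.
  rewrite (bigD1 j)//= eqxx; congr (_ * _).
  by apply: eq_bigr => i /negbTE ->.
have split2 (p : (X -> R) * R) :
    C * \prod_i (if i == j then p else q i).2 = M * p.2.
  rewrite (bigD1 j)//= eqxx mulrCA [LHS]mulrC /M; congr (_ * _ * _).
  by apply: eq_bigr => i /negbTE ->.
have qE i : q i = if i == j then q j else q i by case: eqP => [->|].
have -> : (\int[mu]_x (\prod_i (q i).1 x)%:E
    = \int[mu]_x ((q j).1 x * omega x)%:E)%E.
  apply: eq_integral => x _; rewrite -split1; congr EFin.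
  by apply: eq_bigr => i _; rewrite -qE.
have -> : C * \prod_i (q i).2 = M * (q j).2.
  by rewrite -split2; congr (_ * _); apply: eq_bigr => i _; rewrite -qE.
apply: (step (j := j)).
- rewrite /omega; under eq_fun do rewrite big_mkcond.
  apply: measurable_prod => i _; case: (i != j); last exact: measurable_cst.
  by case: (hq i).
- by move=> x; apply: prodr_ge0 => i _; case: (hq i).
- by rewrite mulr_ge0// prodr_ge0// => i _; case: (hq i).
- move=> p Gp; pose q' i := if i == j then p else q i.
  have := ih us q' _.
  under eq_integral do rewrite split1.
  rewrite split2; apply => i; rewrite /q'.
  have [->|ij] := eqVneq i j; first by rewrite (negbTE js).
  by have := Gq i; rewrite inE (negbTE ij).
by have := Gq j; rewrite mem_head.
Qed.

End ReplaceFactors.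

(** * Exhaustion of the space by a saturating operator *)

Section Exhaustion.
Context {R : realType} {k : scalar_kind}.
Local Notation F := (scalar_field R k).
Local Notation M := (@modulus R k).
Context {d : measure_display} {X : measurableType d}.
Variable mu : {sigma_finite_measure set X -> \bar R}.
Context {Y : Type}.
Variables (D : set (Y -> F)) (T : (Y -> F) -> (X -> F)).
Hypothesis D0 : D !=set0.
Hypothesis mT : forall f, D f -> scalar_measurable (T f).
Hypothesis satT : saturates mu D T.

(** Saturation yields countably many functions whose images have supports
    covering almost all of [X]: take a sequence whose union of supports has
    maximal mass for a finite measure equivalent to [mu]. *)
Lemma saturating_sequence : exists f : nat -> Y -> F,
  (forall n, D (f n)) /\ {ae mu, forall x, exists n, 0 < M (T (f n) x)}.
Proof.
have [rho [mrho rho0 rhoy]] := exists_positive_integrable mu.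
have rho0' x : 0 <= rho x := ltW (rho0 x).
pose supp (f : Y -> F) := [set x | 0 < M (T f x)].
have msupp f : D f -> measurable (supp f).
  move=> Df; rewrite (_ : supp f = (fun x => M (T f x)) @^-1` `]0, +oo[); last first.
    by apply/seteqP; split=> x /=; rewrite in_itv/= andbT.
  rewrite -[_ @^-1` _]setTI.
  exact: (measurable_modulus (mT Df)).
pose S (f : nat -> Y -> F) := \bigcup_n supp (f n).
pose m (A : set X) := fine (\int[mu]_x (rho x * \1_A x)%:E)%E.
have mrA A : measurable A -> measurable_fun setT (fun x => rho x * \1_A x).
  by move=> mA; apply: measurable_funM => //; exact: measurable_indic.
have rA0 A x : 0 <= rho x * (\1_A x : R) by rewrite mulr_ge0.
have rfin : (\int[mu]_x (rho x)%:E \is a fin_num)%E.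
  by rewrite ge0_fin_numE//; apply: integral_ge0 => x _; rewrite lee_fin.
have mE A : measurable A -> ((m A)%:E = \int[mu]_x (rho x * \1_A x)%:E)%E.
  move=> mA; rewrite fineK// ge0_fin_numE; last first.
    by apply: integral_ge0 => x _; rewrite lee_fin.
  apply: le_lt_trans rhoy; apply: integral_EFin_le => //; first exact: mrA.
  by apply: nearW => x; rewrite ler_piMr// indicE; case: (_ \in _).
have m_le A A' : measurable A -> measurable A' -> A `<=` A' -> m A <= m A'.
  move=> mA mA' AA'; rewrite -lee_fin !mE//.
  apply: integral_EFin_le => //; [exact: mrA|exact: mrA|].
  apply: nearW => x; rewrite ler_wpM2l// !indicE ler_nat.
  by case: (boolP (x \in A)) => //; rewrite inE => /AA' Ax; rewrite mem_set.
pose P (f : nat -> Y -> F) := forall n, D (f n).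
have mS f : P f -> measurable (S f).
  by move=> Pf; apply: bigcup_measurable => n _; exact: msupp.
have [f0 Df0] := D0.
pose V f := m (S f).
have hasS : has_sup (V @` P).
  split; first by exists (V (fun=> f0)), (fun=> f0).
  exists (m setT) => _ [f Pf <-]; apply: m_le => //; exact: mS.
have eps0 n : 0 < (n.+1%:R)^-1 :> R by rewrite invr_gt0.
have /choice[g gP] : forall n, exists g, P g /\ sup (V @` P) - (n.+1%:R)^-1 < V g.
  move=> n; have [_ [g Pg <-] hg] := sup_adherent (eps0 n) hasS.
  by exists g.
pose f n := if unpickle n is Some (i, j) then g i j else f0.
have Pf : P f.
  by move=> n; rewrite /f; case: unpickle => [[i j]|] //; case: (gP i).
have Sgf i : S (g i) `<=` S f.
  move=> x [j _ xj]; exists (pickle (i, j)) => //.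
  by rewrite /f /= pickleK.
have V_max h : P h -> V h <= V f.
  move=> Ph; apply: (@le_trans _ _ (sup (V @` P))).
    by apply: sup_upper_bound => //; exists h.
  apply/ler_addgt0Pr => e e0.
  have [n _ hn] : exists2 n, True & (n.+1%:R)^-1 <= e.
    exists (Num.truncn e^-1) => //; rewrite invf_ple ?posrE//.
    have eV0 : 0 <= e^-1 by rewrite invr_ge0 ltW.
    by have /andP[_ /ltW] := truncn_itv eV0.
  have [Pg Vg] := gP n.
  have VgVf : V (g n) <= V f by apply: m_le; [exact: mS|exact: mS|exact: Sgf].
  rewrite -lerBlDr; apply: le_trans VgVf; apply: le_trans (ltW Vg).
  by rewrite lerB.
exists f; split => //.
have mE0 : measurable (~` S f) by apply: measurableC; exact: mS.
suff muE : mu (~` S f) = 0%E.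
  exists (~` S f); split => // x /= nx Sx.
  by apply: nx; have [n _ ?] := Sx; exists n.
apply/eqP; rewrite eq_le measure_ge0 andbT leNgt; apply/negP => muE.
have [E' [measE' E'E muE' [h Dh hE']]] := satT mE0 muE.
pose f' n := if n is n'.+1 then f n' else h.
have Pf' : P f' by case.
have mf' := mS _ Pf'; have mf := mS _ Pf.
have := V_max f' Pf'; apply/negP; rewrite -ltNge.
have V_add : ((V f)%:E + (m E')%:E <= (V f')%:E)%E.
  rewrite /V !mE// -integral_EFinD//; [|exact: mrA..].
  apply: integral_EFin_le => //.
  - by apply: measurable_funD; exact: mrA.
  - exact: mrA.
  - by move=> x; rewrite addr_ge0.
  apply: filterS hE' => x hx; rewrite -mulrDr ler_wpM2l// !indicE.
  have [xE'|xE'] := boolP (x \in E').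
    rewrite inE in xE'; rewrite memNset; last exact: E'E xE'.
    by rewrite add0r mem_set//; exists 0%N => //; exact: hx.
  rewrite addr0 ler_nat; case: (boolP (x \in S f)) => //.
  rewrite inE => -[n _ xn]; rewrite mem_set//.
  by exists n.+1.
have mE'0 : 0 < m E'.
  rewrite lt_neqAle; apply/andP; split; last first.
    by rewrite fine_ge0//; apply: integral_ge0 => x _; rewrite lee_fin.
  apply/negP => /eqP m0.
  have : (\int[mu]_x `|(rho x * \1_E' x)%:E| = 0)%E.
    rewrite -[RHS]/(0%:E) m0 mE//; apply: eq_integral => x _.
    by rewrite gee0_abs// lee_fin.
  move=> /ae_eq_integral_abs h0.
  have mE' : measurable_fun setT (fun x => (rho x * \1_E' x)%:E).
    by apply/measurable_EFinP; exact: mrA.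
  have [N [mN N0 subN]] := h0 measurableT mE'.
  have : (mu E' <= mu N)%E.
    apply: le_measure; rewrite ?inE// => x xE'; apply: subN => /= /(_ I).
    rewrite indicE mem_set// mulr1 => -[] /eqP; apply/negP.
    by rewrite gt_eqF.
  by rewrite N0 leNgt muE'.
by move: V_add; rewrite -EFinD lee_fin; lra.
Qed.

End Exhaustion.
(** * The convex sets attached to an operator *)

Section PowerSums.
Context {R : realType} {k : scalar_kind}.
Local Notation F := (scalar_field R k).
Local Notation M := (@modulus R k).
Context {dX : measure_display} {X : measurableType dX}.
Variable mu : {sigma_finite_measure set X -> \bar R}.
Context {dY : measure_display} {Y : measurableType dY}.
Variables (nu : {measure set Y -> \bar R}) (r p : R).
Hypotheses (r1 : 1 <= r) (p0 : 0 < p).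
Local Notation D := (@simple_Lr R k dY Y nu r).
Local Notation N := (@rnorm R k dY Y nu r).
Variable T : (Y -> F) -> (X -> F).
Hypothesis linT : linear_operator mu D T.

(** Sub-probability weights rather than lists of functions with bounded
    [p]-sums of norms make convexity immediate. *)
Definition power_sums : set (X -> R) := [set u |
  exists (I : finType) (w : I -> R) (f : I -> Y -> F),
  [/\ forall i, 0 <= w i, \sum_i w i <= 1, forall i, D (f i),
      forall i, N (f i) <= 1
    & u = fun x => \sum_i w i * M (T (f i) x) `^ p]].

Lemma power_sums_measurable u : power_sums u -> measurable_fun setT u.
Proof.
move=> [I [w [f [w0 _ Df _ ->]]]].
apply: measurable_sum => i; apply: measurable_funM; first exact: measurable_cst.
apply: measurable_powRl; apply: measurable_modulus.
exact: operator_measurable linT _ (Df i).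
Qed.

Lemma power_sums_ge0 u x : power_sums u -> 0 <= u x.
Proof.
move=> [I [w [f [w0 _ _ _ ->]]]].
by apply: sumr_ge0 => i _; rewrite mulr_ge0// powR_ge0.
Qed.

Lemma power_sums_convex u v t : power_sums u -> power_sums v -> 0 <= t <= 1 ->
  power_sums (fun x => (1 - t) * u x + t * v x).
Proof.
move=> [I [w [f [w0 w1 Df Nf ->]]]] [I' [w' [f' [w0' w1' Df' Nf' ->]]]].
move=> /andP[t0 t1]; have s0 : 0 <= 1 - t by rewrite subr_ge0.
exists (I + I')%type.
exists (fun i => match i with inl a => (1 - t) * w a | inr b => t * w' b end).
exists (fun i => match i with inl a => f a | inr b => f' b end).
split.
- by move=> [a|b]; rewrite mulr_ge0.
- rewrite big_sumType/= -!mulr_sumr.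
  have := ler_wpM2l s0 w1; have := ler_wpM2l t0 w1'; lra.
- by case.
- by case.
apply/funext => x; rewrite big_sumType/= !mulr_sumr.
by congr (_ + _); apply: eq_bigr => i _; rewrite mulrA.
Qed.

Lemma power_sums1 f : D f -> N f <= 1 ->
  power_sums (fun x => M (T f x) `^ p).
Proof.
move=> Df Nf; exists unit, (fun=> 1), (fun=> f); split => //.
- by rewrite sumr_const card_unit.
- by apply/funext => x; rewrite sumr_const card_unit mul1r.
Qed.

(** Enlarging sub-probability weights to probability weights only increases
    the sum. *)
Lemma power_sums_bound (omega : X -> R) (g B : R) u :
  measurable_fun setT omega -> (forall x, 0 <= omega x) ->
  0 < g -> g <= p -> (r < 2 -> p < r) -> (2 <= r -> p <= 2) -> 0 <= B ->
  (forall f, D f ->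
    (\int[mu]_x (M (T f x) `^ g * omega x)%:E <= (B * N f `^ g)%:E)%E) ->
  power_sums u ->
  (\int[mu]_x (u x `^ (g / p) * omega x)%:E <= (B * vv_const g r p)%:E)%E.
Proof.
move=> momega omega0 g0 gp pr p2 B0 boundT Ku; have mu_ := power_sums_measurable Ku.
have u0 x := power_sums_ge0 x Ku.
have C0 := vv_const_gt0 r g0 p0; have th0 : 0 < g / p by rewrite divr_gt0.
move: Ku => [I [w [f [w0 w1 Df Nf uE]]]].
have [W0|Wn0] := eqVneq (\sum_i w i) 0.
  have u00 x : u x = 0.
    rewrite uE; apply: big1 => i _.
    move/eqP: W0; rewrite psumr_eq0// => /allP/(_ i).
    by rewrite mem_index_enum => /(_ isT)/eqP ->; rewrite mul0r.
  under eq_integral do rewrite u00 powR0 ?gt_eqF// mul0r.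
  by rewrite integral0 lee_fin mulr_ge0// ltW.
have Wp : 0 < \sum_i w i by rewrite lt_neqAle eq_sym Wn0 sumr_ge0.
pose w' i := w i / \sum_i w i.
have w'0 i : 0 <= w' i by rewrite divr_ge0// ltW.
have w'1 : \sum_i w' i = 1 by rewrite -mulr_suml mulfV.
apply: le_trans (vector_valued_bound r1 linT momega omega0 g0 B0 boundT Df Nf
  w'0 w'1 p0 gp pr p2).
have q0 x : 0 <= \sum_i w' i * M (T (f i) x) `^ p.
  by apply: sumr_ge0 => i _; rewrite mulr_ge0// powR_ge0.
apply: integral_EFin_le.
- by apply: measurable_funM => //; exact: measurable_powRl.
- apply: measurable_funM => //; apply: measurable_powRl.
  apply: measurable_sum => i; apply: measurable_funM; first exact: measurable_cst.
  apply: measurable_powRl; apply: measurable_modulus.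
  exact: operator_measurable linT _ (Df i).
- by move=> x; rewrite mulr_ge0// powR_ge0.
- by move=> x; rewrite mulr_ge0// powR_ge0.
apply: nearW => x; rewrite ler_wpM2r// ge0_ler_powR ?nnegrE ?(ltW th0)//.
rewrite uE; apply: ler_sum => i _; rewrite ler_wpM2r ?powR_ge0//.
by rewrite ler_pdivlMr// ler_piMr.
Qed.

(** Along a saturating sequence normalized in [L^r], partial sums with geometric
    weights increase, stay in the class and become positive almost everywhere. *)
Lemma power_sums_exhaustion : saturates mu D T -> exists h : nat -> X -> R,
  [/\ forall n, power_sums (h n), forall n x, h n x <= h n.+1 x
    & {ae mu, forall x, exists n, 0 < h n x}].
Proof.
move=> satT.
have D0 : D !=set0 by exists (fun=> 0); exact: simple_Lr0.
have mT f : D f -> scalar_measurable (T f) by exact: operator_measurable linT f.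
have [f [Df fpos]] := saturating_sequence D0 mT satT.
pose a n : R := (1 + N (f n))^-1.
have a0 n : 0 < a n by rewrite invr_gt0 ltr_pwDl// rnorm_ge0.
pose g n := fun y => ofR k (a n) * f n y.
have Dg n : D (g n) by exact: simple_LrZ.
have Ng n : N (g n) <= 1.
  rewrite rnormZ// modulus_ofR gtr0_norm// mulrC ler_pdivrMr ?ltr_pwDl ?rnorm_ge0//.
  by rewrite mul1r lerDr.
pose w n : R := 2^-1 ^+ n.+1.
have w0 n : 0 < w n by rewrite exprn_gt0// invr_gt0.
pose h n x := \sum_(i < n.+1) w i * M (T (g i) x) `^ p.
exists h; split.
- move=> n; exists 'I_n.+1, (fun i : 'I_n.+1 => w i), (fun i : 'I_n.+1 => g i); split => //.
    by move=> i; exact: ltW.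
  have q01 : 0 <= (2^-1 : R) < 1 by apply/andP; split; lra.
  have := geometric_psum_le n.+1 q01.
  have -> : (1 - 2^-1)^-1 = 2 :> R by field.
  under [X in _ -> X <= _]eq_bigr do rewrite /w exprS.
  by rewrite -mulr_sumr; lra.
- move=> n x; rewrite /h [leRHS]big_ord_recr/= lerDl mulr_ge0 ?powR_ge0//.
  exact: ltW.
have gZ : {ae mu, forall x, forall n, T (g n) x = ofR k (a n) * T (f n) x}.
  by apply: ae_foralln => n; exact: (operatorZ r1 linT _ (Df n)).
apply: filterS2 fpos gZ => x [n fn] gx; exists n.
rewrite /h big_ord_recr/= ltr_wpDl ?sumr_ge0//.
  by move=> i _; rewrite mulr_ge0 ?powR_ge0// ltW.
by rewrite mulr_gt0// powR_gt0// gx modulusM modulus_ofR gtr0_norm// mulr_gt0.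
Qed.

(** Homogeneity passes from the unit ball to all simple functions. *)
Lemma power_sums_weight (phi : X -> R) (C : R) : 0 < C ->
  measurable_fun setT phi -> (forall x, 0 <= phi x) ->
  (forall u, power_sums u -> (\int[mu]_x (u x * phi x)%:E <= (C `^ p)%:E)%E) ->
  forall f, D f ->
    ((\int[mu]_x (M (T f x) `^ p * phi x)%:E) `^ p^-1
       <= C%:E * Lr_norm nu r f)%E.
Proof.
move=> C0 mphi phi0 unit_bound f Df; have rf := rnorm_ge0 nu r f.
have mTf h : D h -> measurable_fun setT (fun x => M (T h x) `^ p * phi x).
  move=> Dh; apply: measurable_funM => //; apply: measurable_powRl.
  by apply: measurable_modulus; exact: operator_measurable linT _ Dh.
rewrite -rnormE// -EFinM; apply/lee_addgt0Pr => e e0.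
(* The norm of [f] may vanish, hence the scaling by a larger number. *)
pose rho := N f + e / C.
have rho0 : 0 < rho by rewrite ltr_wpDl// divr_gt0.
rewrite -EFinD [X in (_ <= X%:E)%E](_ : _ = C * rho); last first.
  by rewrite /rho; field; rewrite gt_eqF.
have Cr : 0 <= C * rho by rewrite mulr_ge0// ltW.
have -> : ((C * rho)%:E = ((C * rho) `^ p)%:E `^ p^-1)%E.
  by rewrite poweR_EFin -powRrM mulfV ?gt_eqF// powRr1.
apply: gt0_ler_poweR.
- by rewrite invr_ge0 ltW.
- by rewrite in_itv/= leey andbT; apply: integral_ge0 => x _;
    rewrite lee_fin mulr_ge0// powR_ge0.
- by rewrite in_itv/= leey andbT lee_fin powR_ge0.
pose g := fun y => ofR k rho^-1 * f y.
have Dg : D g by exact: simple_LrZ.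
have Ng : N g <= 1.
  rewrite rnormZ// modulus_ofR gtr0_norm ?invr_gt0// mulrC ler_pdivrMr// mul1r.
  by rewrite /rho lerDl divr_ge0 ?ltW.
apply: (@le_trans _ _ (\int[mu]_x (rho `^ p * (M (T g x) `^ p * phi x))%:E)%E).
  apply: integral_EFin_le.
  - exact: mTf.
  - by apply: measurable_funM; [exact: measurable_cst|exact: mTf].
  - by move=> x; rewrite mulr_ge0// powR_ge0.
  - by move=> x; rewrite !mulr_ge0 ?powR_ge0.
  apply: filterS (operatorZ r1 linT (ofR k rho^-1) Df) => x ->.
  rewrite modulusM modulus_ofR gtr0_norm ?invr_gt0// mulrA.
  rewrite -powRM ?mulr_ge0 ?modulus_ge0 ?invr_ge0 ?(ltW rho0)//.
  by rewrite mulrA mulfV ?gt_eqF// mul1r.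
rewrite integral_EFinZ ?powR_ge0//; last 2 first.
- exact: mTf.
- by move=> x; rewrite mulr_ge0// powR_ge0.
rewrite mulrC powRM ?(ltW C0) ?(ltW rho0)// EFinM.
rewrite lee_wpmul2l ?lee_fin ?powR_ge0//.
exact: (unit_bound _ (power_sums1 Dg Ng)).
Qed.

End PowerSums.
(** * Factorization for operators on simple functions *)

Lemma prod_powR_exponent (R : realType) (I : Type) (s : seq I) (a : I -> R)
    (x : R) : 0 < x -> \prod_(i <- s) x `^ a i = x `^ (\sum_(i <- s) a i).
Proof.
move=> x0; rewrite /powR gt_eqF//.
by rewrite mulr_suml expR_sum; apply: eq_bigr => i _; rewrite ?gt_eqF.
Qed.

Theorem theorem1p5 (R : realType) (d : nat) (gamma r p : 'I_d -> R)
    (hr : forall j, 1 <= r j)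
    (hgamma : forall j, 0 < gamma j)
    (hsum : \sum_(j < d) gamma j / p j = 1)
    (hp1 : forall j, r j < 2 -> 0 < p j < r j)
    (hp2 : forall j, 2 <= r j -> 0 < p j <= 2) :
  exists C : R,
  forall (k : scalar_kind)
    (dX : measure_display) (X : measurableType dX)
    (mu : {sigma_finite_measure set X -> \bar R})
    (dY : 'I_d -> measure_display) (Y : forall j, measurableType (dY j))
    (nu : forall j, {measure set (Y j) -> \bar R})
    (T : forall j, (Y j -> scalar_field R k) -> (X -> scalar_field R k))
    (A : R),
  (forall j, linear_operator mu (simple_Lr (nu j) (r j)) (T j)) ->
  (forall j, saturates mu (simple_Lr (nu j) (r j)) (T j)) ->
  0 <= A ->
  (forall f : forall j, Y j -> scalar_field R k,
     (forall j, simple_Lr (nu j) (r j) (f j)) ->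
     (\int[mu]_x (\prod_(j < d) modulus (T j (f j) x) `^ gamma j)%:E
      <= (A `^ (\sum_(j < d) gamma j))%:E *
         \prod_(j < d) Lr_norm (nu j) (r j) (f j) `^ gamma j)%E) ->
  exists phi : 'I_d -> X -> R,
  [/\ forall j, measurable_fun [set: X] (phi j),
      forall j x, 0 <= phi j x,
      {ae mu, forall x, 1 <= \prod_(j < d) phi j x `^ (gamma j / p j)}
    & forall j (f : Y j -> scalar_field R k), simple_Lr (nu j) (r j) f ->
        ((\int[mu]_x (modulus (T j f x) `^ p j * phi j x)%:E) `^ (p j)^-1
         <= (C * A)%:E * Lr_norm (nu j) (r j) f)%E].
Proof.
have p0 j : 0 < p j.
  by have [/hp1/andP[]|/hp2/andP[]] := ltP (r j) 2.
have th0 j : 0 < gamma j / p j by rewrite divr_gt0.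
have gp j : gamma j <= p j.
  have : gamma j / p j <= 1.
    by rewrite -hsum (bigD1 j)//= lerDl sumr_ge0// => i _; exact: ltW.
  by rewrite ler_pdivrMr// mul1r.
pose Cv j := vv_const (gamma j) (r j) (p j).
have Cv0 j : 0 < Cv j by exact: vv_const_gt0.
pose c0 := 6 * \prod_j Cv j.
have c00 : 0 < c0 by rewrite mulr_gt0// prodr_gt0.
exists (\sum_j c0 `^ (p j)^-1) => k dX X mu dY Y nu T A linT satT A0 boundT.
set C := \sum_j _; set G := \sum_j gamma j.
pose K j := power_sums (nu j) (r j) (p j) (T j).
pose N j := @rnorm R k _ (Y j) (nu j) (r j).
have AG0 : 0 <= A `^ G by exact: powR_ge0.
have K_bound u : (forall j, K j (u j)) ->
    (\int[mu]_x (\prod_j u j x `^ (gamma j / p j))%:E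
     <= (A `^ G * \prod_j Cv j)%:E)%E.
  move=> Ku.
  pose single j := [set q : (X -> R) * R | exists2 f,
    simple_Lr (nu j) (r j) f &
    q = ((fun x => modulus (T j f x) `^ gamma j), N j f `^ gamma j)].
  pose sums j := [set q : (X -> R) * R | exists2 u, K j u &
    q = ((fun x => u x `^ (gamma j / p j)), Cv j)].
  have := @replace_factors R _ X mu _ single sums (A `^ G) _ _ AG0 _ _
    (fun j => ((fun x => u j x `^ (gamma j / p j)), Cv j)).
  apply.
  - move=> j q [f Df ->]; split => /=; last exact: powR_ge0.
      apply: measurable_powRl; apply: measurable_modulus.
      exact: operator_measurable (linT j) _ Df.
    by move=> x; exact: powR_ge0.
  - move=> j q [v Kv ->]; split => /=; last exact: ltW.
      apply: measurable_powRl; exact: (power_sums_measurable (linT j) Kv).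
    by move=> x; exact: powR_ge0.
  - move=> j omega M momega omega0 M0 hM q [v Kv ->] /=.
    apply: (power_sums_bound (hr j) (p0 j) (linT j)) => //.
    + by move=> /hp1/andP[].
    + by move=> /hp2/andP[].
    + by move=> f Df; exact: (hM _ (ex_intro2 _ _ f Df erefl)).
  - move=> q /fin_all_exists2[f Df qE].
    under eq_integral do under eq_bigr do rewrite qE.
    under [X in (_ <= (_ * X)%:E)%E]eq_bigr do rewrite qE.
    apply: (le_trans (boundT f Df)).
    rewrite EFinM -prodEFin le_eqVlt; apply/orP; left; apply/eqP.
    congr (_ * _)%E; apply: eq_bigr => j _.
    by rewrite -(rnormE (Df j)) poweR_EFin.
  - by move=> j; exists (u j).
have /fin_all_exists[h hP] : forall j, exists h : nat -> X -> R,
    [/\ forall n, K j (h n), forall n x, h n x <= h n.+1 x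
      & {ae mu, forall x, exists n, 0 < h n x}].
  by move=> j; exact: (power_sums_exhaustion (p j) (hr j) (linT j) (satT j)).
have h_pos : {ae mu, forall x j, exists n, 0 < h j n x}.
  by apply: filter_forall => j; case: (hP j).
have [AE|An0] := eqVneq A 0.
  (* A bound by zero forces all products to vanish almost everywhere, which
     the positivity of the [h j n] only allows on a null space. *)
  have G0 : 0 < G.
    rewrite lt_neqAle sumr_ge0 ?andbT => [|j _]; last exact: ltW.
    apply/negP => /eqP/esym/eqP; rewrite psumr_eq0 => [/allP h0|j _]; last exact: ltW.
    move: hsum; rewrite big1 => [/eqP|j _]; first by rewrite eq_sym oner_eq0.
    by have := h0 j (mem_index_enum j); rewrite gt_eqF.
  have prod0 n : {ae mu, forall x, \prod_j h j n x `^ (gamma j / p j) = 0}.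
    have Kh j : K j (h j n) by have [] := hP j.
    have mprod : measurable_fun setT
        (fun x => (\prod_j h j n x `^ (gamma j / p j))%:E).
      apply/measurable_EFinP; apply: measurable_prod => j _.
      by apply: measurable_powRl; exact: (power_sums_measurable (linT j) (Kh j)).
    have prod_ge0 x : 0 <= \prod_j h j n x `^ (gamma j / p j).
      by apply: prodr_ge0 => j _; exact: powR_ge0.
    have : (\int[mu]_x `|(\prod_j h j n x `^ (gamma j / p j))%:E| = 0)%E.
      under eq_integral do rewrite gee0_abs ?lee_fin//.
      apply/eqP; rewrite eq_le integral_ge0 ?andbT; last first.
        by move=> x _; rewrite lee_fin.
      have := K_bound (fun j => h j n) Kh.
      by rewrite AE powR0 ?mul0r// gt_eqF.
    move=> /ae_eq_integral_abs h0; apply: filterS (h0 measurableT mprod) => x.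
    by move=> /(_ I)[].
  have nullX : {ae mu, forall x, False}.
    apply: filterS2 h_pos (ae_foralln prod0) => x /fin_all_exists[m hm].
    move=> /(_ (\max_j m j)%N)/eqP; apply/negP; rewrite gt_eqF//.
    apply: prodr_gt0 => j _; rewrite powR_gt0// (lt_le_trans (hm j))//.
    have [_ mono _] := hP j.
    have /subnK <- := @leq_bigmax _ m j.
    by elim: (_ - _)%N => [|i ih] //; rewrite addSn (le_trans ih).
  exists (fun _ _ => 0); split => //.
  - by apply: filterS nullX.
  - move=> j f Df; under eq_integral do rewrite mulr0.
    rewrite integral0 poweR0r ?invr_eq0 ?gt_eqF//.
    rewrite mule_ge0// ?Lnorm_ge0// lee_fin mulr_ge0// sumr_ge0// => i _.
    exact: powR_ge0.
have {An0} A1 : 0 < A by rewrite lt_neqAle eq_sym An0.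
have B0 : 0 < A `^ G * \prod_j Cv j.
  by rewrite mulr_gt0 ?powR_gt0// prodr_gt0.
have [phi [mphi phi0 phi1 phiK]] := @convex_factorization R _ X mu _
  (fun j => gamma j / p j) K (fun n j => h j n) _ th0 hsum B0
  (fun j u Ku => power_sums_measurable (linT j) Ku)
  (fun j u x Ku => power_sums_ge0 x Ku)
  (fun j u v t Ku Kv => power_sums_convex Ku Kv) K_bound
  (fun n j => let: And3 Kh _ _ := hP j in Kh n)
  (fun n j x => let: And3 _ mono _ := hP j in mono n x) h_pos.
pose lam j := A `^ (p j - G).
have lam0 j : 0 < lam j by rewrite powR_gt0.
exists (fun j x => lam j * phi j x); split.
- by move=> j; apply: measurable_funM => //; exact: measurable_cst.
- by move=> j x; rewrite mulr_ge0// ltW.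
- apply: filterS phi1 => x /le_trans; apply.
  under [leRHS]eq_bigr do rewrite powRM ?(ltW (lam0 _))//.
  rewrite big_split/= ler_peMl//; first by apply: prodr_ge0 => j _; exact: powR_ge0.
  rewrite (eq_bigr (fun j => A `^ (gamma j - G * (gamma j / p j)))); last first.
    move=> j _; rewrite -powRrM; congr (_ `^ _); field; exact: lt0r_neq0.
  rewrite prod_powR_exponent// sumrB -mulr_sumr hsum mulr1 subrr powRr0//.
move=> j f Df.
pose D := c0 `^ (p j)^-1 * A.
have D0 : 0 < D by rewrite mulr_gt0 ?powR_gt0.
have DE : D `^ p j = 6 * (A `^ G * \prod_i Cv i) * lam j.
  rewrite powRM ?powR_ge0 ?(ltW A1)// -powRrM mulVf ?lt0r_neq0// powRr1 ?(ltW c00)//.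
  rewrite /c0 /lam (_ : A `^ p j = A `^ G * A `^ (p j - G)); first by ring.
  by rewrite -powRD ?(gt_eqF A1) ?implybT// subrKC.
apply: (@le_trans _ _ (D%:E * Lr_norm (nu j) (r j) f)%E).
  apply: (power_sums_weight (hr j) (p0 j) (linT j) D0 _ _ _ Df).
  - by apply: measurable_funM => //; exact: measurable_cst.
  - by move=> x; rewrite mulr_ge0// ltW.
  move=> u Ku; rewrite DE.
  have -> : (\int[mu]_x (u x * (lam j * phi j x))%:E
      = \int[mu]_x (lam j * (u x * phi j x))%:E)%E.
    by apply: eq_integral => x _; rewrite mulrCA.
  have mu_ := power_sums_measurable (linT j) Ku.
  have u0 x := power_sums_ge0 x Ku.
  rewrite integral_EFinZ ?(ltW (lam0 j))//; last 2 first.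
  - exact: measurable_funM.
  - by move=> x; rewrite mulr_ge0.
  rewrite mulrC EFinM lee_wpmul2l ?lee_fin ?(ltW (lam0 j))//.
  exact: phiK.
rewrite lee_wpmul2r ?Lnorm_ge0// lee_fin ler_pM2r// /C.
by rewrite (bigD1 j)//= lerDl sumr_ge0// => i _; exact: powR_ge0.
Qed.
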